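(* Let $G$ be a connected graph with at least one end. The following are equivalent: (1) There is a tree-decomposition of $G$ of finite adhesion that represents $\Omega(G)$. (2) There is a tree-decomposition of $G$ of finite adhesion that distinguishes $\Omega(G)$. (3) There is a tree-decomposition of $G$ of finite adhesion into ${\leq}1$-ended parts. (4) $V(G)$ is a countable union of slender sets of vertices.
   Context: Ends. A ray is a one-way infinite path. Two rays in a graph $G$ are equivalent if no finite set of vertices separates them; the equivalence classes are the ends of $G$, and $\Omega(G)$ is the set of ends. For a finite $X\subseteq V(G)$ and $\omega\in\Omega(G)$, $C(X,\omega)$ is the unique component of $G-X$ containing a tail of every ray in $\omega$; we say that $\omega$ lives in $C(X,\omega)$. Let $\Omega(X,\omega)$ be the set of all ends $\phi$ with $C(X,\phi)=C(X,\omega)$. The space $|G|$. $|G|$ is the set $G\cup\Omega(G)$ ($G$ viewed as a 1-complex, every edge being a copy of the unit interval) with the topology MTop, which has as a basis all open sets of $G$ as a metric length space (every edge of length 1), together with, for every end $\omega$, finite $X\subseteq V(G)$ and $0<\varepsilon<1$, the sets $\hat C_\varepsilon(X,\omega)$ consisting of $C(X,\omega)$ (with its edges), all ends in $\Omega(X,\omega)$, and all points on edges between $X$ and $C(X,\omega)$ at distance less than $\varepsilon$ from the endvertex in $C(X,\omega)$. Closures of sets of vertices are taken in $|G|$. Slender sets. For a topological space $X$, let $X^{(0)}=X$ and let $X^{(n+1)}$ be the subspace of $X^{(n)}$ obtained by deleting all isolated points of $X^{(n)}$. A set $U\subseteq V(G)$ is slender if the subspace $X=\overline U\subseteq|G|$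 satisfies $X^{(n)}=\emptyset$ for some $n\in\mathbb N$. Tree-decompositions. A tree-decomposition of $G$ is a pair $\mathcal T=(T,\mathcal V)$ of a tree $T$ and a family $\mathcal V=(V_t)_{t\in T}$ of subsets of $V(G)$ (the parts) such that every vertex of $G$ lies in some $V_t$, every edge of $G$ lies in some $G[V_t]$, and $V_{t_1}\cap V_{t_3}\subseteq V_{t_2}$ whenever $t_2$ lies on the path from $t_1$ to $t_3$ in $T$. For an edge $e=xy$ of $T$ let $T_x\ni x$ and $T_y\ni y$ be the components of $T-e$, $A_x=\bigcup_{t\in T_x}V_t$, $A_y=\bigcup_{t\in T_y}V_t$ and $X_e=V_x\cap V_y$. $\mathcal T$ has finite adhesion if all $X_e$ are finite. In that case every end $\omega$ of $G$ orients each edge $e=xy$ of $T$ towards $x$ or $y$ according to whether $\omega$ lives in a component of $G[A_x]-X_e$ or of $G[A_y]-X_e$; this orientation points towards a unique node of $T$ ($\omega$ lives in that part) or towards a unique end of $T$ ($\omega$ corresponds to that end), and $f_{\mathcal T}:\Omega(G)\to V(T)\cup\Omega(T)$ sends $\omega$ to this node or end. $\mathcal T$ distinguishes $\Omega(G)$ if $f_{\mathcal T}$ is injective, and represents $\Omega(G)$ if $f_{\mathcal T}$ is a bijection onto $V(T)\cup\Omega(T)$. $\mathcal T$ is into ${\le}1$-ended parts if for every node $t$ of $T$ at most one end of $G$ is mapped to $t$ by $f_{\mathcal T}$. *)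

(* Defs.v *)
From HB Require Import structures.
From mathcomp Require Import all_boot all_order all_algebra.
From mathcomp Require Import all_classical all_reals ereal topology.
From mathcomp Require Import finmap lra.

Set Implicit Arguments.
Unset Strict Implicit.
Unset Printing Implicit Defensive.

Import Order.TTheory GRing.Theory Num.Theory.

Local Open Scope classical_set_scope.
Local Open Scope ring_scope.

(* Simple graphs of arbitrary cardinality. *)
Record sgraph := SGraph {
  vertex :> choiceType;
  adj : rel vertex;
  adj_sym : symmetric adj;
  adj_irr : irreflexive adj }.

Section Graphs.
Variable G : sgraph.
Implicit Types (A X C : set G) (u v : G) (r : nat -> G).

(* [linked A u v]: u and v are joined by a path in the induced subgraph G[A]. *)
Definition linked A u v :=
  exists s, [/\ path (@adj G) u s, last u s = v & [set` u :: s] `<=` A].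

Definition connected_graph :=
  [set: G] !=set0 /\ forall u v, linked setT u v.

Definition is_component A C :=
  exists2 u, A u & C = [set v | linked A u v].

(* [ucycle adj c] also holds for the closed walks c of length at most 2. *)
Definition acyclic := forall c : seq G, ucycle (@adj G) c -> (size c <= 2)%N.

Definition is_tree := connected_graph /\ acyclic.

Definition is_ray r :=
  injective r /\ forall n, adj (r n) (r n.+1).

Definition separates X A B := forall u s,
  A u -> path (@adj G) u s -> B (last u s) -> [set` u :: s] `&` X !=set0.

Definition ray_equiv r r' :=
  forall X, finite_set X -> ~ separates X (range r) (range r').

Definition ends : set (set (nat -> G)) :=
  [set w | exists2 r, is_ray r & w = [set r' | is_ray r' /\ ray_equiv r r']].

(* [tail_in A r]: some tail of r is contained in A. *)
Definition tail_in A r := exists n, forall m, (n <= m)%N -> A (r m).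

(* C(X, w). It is written as the union of all components of G - X that contain
   a tail of every ray of w; for finite X there is exactly one such component
   (lemma end_compP below). *)
Definition end_comp X (w : ends) : set G :=
  [set v | exists C, [/\ is_component (~` X) C,
                         forall r, val w r -> tail_in C r & C v]].

Lemma linked_refl A u : A u -> linked A u u.
Proof.
move=> Au; exists [::]; split => // v /=.
by rewrite inE => /eqP ->.
Qed.

Lemma linked_trans A u v w : linked A u v -> linked A v w -> linked A u w.
Proof.
move=> [s [ps <- sA]] [s' [ps' <- sA']]; exists (s ++ s'); split.
- by rewrite cat_path ps.
- by rewrite last_cat.
- move=> x /=; rewrite -cat_cons mem_cat => /orP[xs|xs].
    exact: sA.
  by apply: sA'; rewrite /= inE xs orbT.
Qed.

Lemma linkedS A B u v : A `<=` B -> linked A u v -> linked B u v.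
Proof.
by move=> AB [s [ps ls sA]]; exists s; split => //; exact: subset_trans AB.
Qed.

Lemma linked_start A u v : linked A u v -> A u.
Proof. by move=> [s [_ _]]; apply; rewrite /= inE eqxx. Qed.

Lemma linked_adj A u v : A u -> A v -> adj u v -> linked A u v.
Proof.
move=> Au Av uv; exists [:: v]; split => //=; first by rewrite uv.
by move=> x /=; rewrite !inE => /orP[/eqP ->|/eqP ->].
Qed.

Lemma linked_sym A u v : linked A u v -> linked A v u.
Proof.
move=> [s [ps <- sA]]; elim: s u ps sA => [|x s IH] u /=.
  by move=> _ sA; apply/linked_refl/sA; rewrite /= inE eqxx.
move=> /andP[ux ps] sA.
have Au : A u by apply: sA; rewrite /= inE eqxx.
have Ax : A x by apply: sA; rewrite /= !inE eqxx orbT.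
apply: (@linked_trans _ _ x).
  by apply: IH => // y ys; apply: sA; rewrite /= inE; apply/orP; right.
by apply: linked_adj => //; rewrite adj_sym.
Qed.

Lemma linked_end A u v : linked A u v -> A v.
Proof. by move/linked_sym/linked_start. Qed.

Lemma component_eq A C C' v :
  is_component A C -> is_component A C' -> C v -> C' v -> C = C'.
Proof.
move=> [u _ ->] [u' _ ->] /= uv u'v.
apply/seteqP; split => x /= h.
  exact: linked_trans u'v (linked_trans (linked_sym uv) h).
exact: linked_trans uv (linked_trans (linked_sym u'v) h).
Qed.

Lemma ray_avoids X r : is_ray r -> finite_set X -> tail_in (~` X) r.
Proof.
move=> [rinj _] Xfin.
have /finite_fsetP[Y eY] : finite_set (r @^-1` X).
  by apply: finite_preimage => // x y _ _; exact: rinj.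
exists (\max_(i <- enum_fset Y) i).+1 => m mY Xm.
have : [set` Y] m by rewrite -eY.
move=> /= mYm; have := @leq_bigmax_seq _ (enum_fset Y) xpredT id m mYm isT.
by rewrite leqNgt mY.
Qed.

Lemma ray_equiv_refl r : is_ray r -> ray_equiv r r.
Proof.
move=> rr X Xfin; have [n nX] := ray_avoids rr Xfin.
move=> sep; have := sep (r n) [::] (ex_intro2 _ _ n I erefl) isT (ex_intro2 _ _ n I erefl).
by case=> x /=; rewrite inE => -[/eqP ->]; exact: nX.
Qed.

Lemma ray_linked A r n m : is_ray r ->
  (forall k, (n <= k)%N -> A (r k)) -> (n <= m)%N -> linked A (r n) (r m).
Proof.
move=> [_ ra] rA; elim: m => [|m IH].
  by rewrite leqn0 => /eqP n0; rewrite n0; apply/linked_refl/rA; rewrite n0.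
rewrite leq_eqVlt => /orP[/eqP nm|nm]; first by rewrite nm; apply/linked_refl/rA; rewrite nm.
apply: linked_trans (IH nm) _.
by apply: linked_adj => //; apply: rA => //; exact: leqW.
Qed.

Lemma end_ray (w : ends) r : val w r -> is_ray r.
Proof. by case: w => w /= /set_mem [r0 _ ->] []. Qed.

Lemma end_compP X (w : ends) : finite_set X ->
  is_component (~` X) (end_comp X w) /\
  forall r, val w r -> tail_in (end_comp X w) r.
Proof.
move=> Xfin; case: w => w wP; have [r rr ew] := set_mem wP.
have [n nX] := ray_avoids rr Xfin.
pose C := [set v | linked (~` X) (r n) v].
have Ccomp : is_component (~` X) C by exists (r n) => //; exact: nX.
have Ctail r' : w r' -> tail_in C r'.
  rewrite ew => -[rr' req]; have [n' nX'] := ray_avoids rr' Xfin.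
  pose Y := X `|` (r @` `I_n `|` r' @` `I_n').
  have Yfin : finite_set Y.
    by rewrite !finite_setU; do !split => //; apply: finite_image; exact: finite_II.
  have /existsNP[u /existsNP[s /not_implyP[[i _ ri] /not_implyP[ps]]]] := req _ Yfin.
  move=> /not_implyP[[j _ rj] /nonemptyPn sY].
  have sY' x : x \in u :: s -> ~ Y x.
    move=> xs Yx; have : ([set` u :: s] `&` Y) x by split.
    by rewrite sY.
  have ni : (n <= i)%N.
    rewrite leqNgt; apply/negP => lin; apply: (sY' u); first by rewrite inE eqxx.
    by right; left; exists i.
  have nj : (n' <= j)%N.
    rewrite leqNgt; apply/negP => ljn; apply: (sY' (last u s)).
      exact: mem_last.
    by right; right; exists j.
  have l1 := ray_linked rr nX ni.
  have l2 : linked (~` X) (r i) (r' j).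
    exists s; rewrite ri rj; split => // x /= xs Xx.
    by apply: (sY' x xs); left.
  have l3 := linked_sym (ray_linked rr' nX' nj).
  exists n' => m n'm; rewrite /C /=.
  apply: linked_trans (ray_linked rr' nX' n'm).
  exact: linked_trans l1 (linked_trans l2 l3).
have wr : w r by rewrite ew; split => //; exact: ray_equiv_refl.
have eC : end_comp X (exist _ w wP) = C.
  apply/seteqP; split => [v [C' [C'comp C'tail C'v]]|v Cv]; last first.
    by exists C; split.
  have [a aC] := Ctail _ wr; have [b bC] := C'tail _ wr.
  rewrite (component_eq Ccomp C'comp (v := r (maxn a b))) //.
    exact/aC/leq_maxl.
  exact/bC/leq_maxr.
by rewrite eC.
Qed.

Lemma end_nonempty (w : ends) : exists r, val w r.
Proof.
case: w => w /= /set_mem [r rr ->]; exists r; split => //.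
exact: ray_equiv_refl.
Qed.

Lemma end_compS X Y (w : ends) : finite_set X -> finite_set Y -> X `<=` Y ->
  end_comp Y w `<=` end_comp X w.
Proof.
move=> Xfin Yfin XY v; have [[u uX eX] tX] := end_compP w Xfin.
have [[u' u'Y eY] tY] := end_compP w Yfin.
have [r wr] := end_nonempty w.
have [a aC] := tX r wr; have [b bC] := tY r wr.
pose m := maxn a b.
have : end_comp X w (r m) by exact/aC/leq_maxl.
have : end_comp Y w (r m) by exact/bC/leq_maxr.
rewrite eX eY /= => h1 h2 h3; apply: linked_trans h2 _.
have YX : ~` Y `<=` ~` X by exact: subsetC.
exact: linked_trans (linkedS YX (linked_sym h1)) (linkedS YX h3).
Qed.

Lemma end_comp_eqS X Y (w w' : ends) :
  finite_set X -> finite_set Y -> X `<=` Y ->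
  end_comp Y w = end_comp Y w' -> end_comp X w = end_comp X w'.
Proof.
move=> Xfin Yfin XY e; have [[u uY eY] _] := end_compP w Yfin.
have Yu : end_comp Y w u by rewrite eY; exact: linked_refl.
apply: (component_eq (end_compP w Xfin).1 (end_compP w' Xfin).1 (v := u)).
  exact: (end_compS Xfin Yfin XY).
by apply: (end_compS Xfin Yfin XY); rewrite -e.
Qed.

Lemma end_comp_adj X (w : ends) u v : finite_set X ->
  end_comp X w u -> adj u v -> ~ X v -> end_comp X w v.
Proof.
move=> Xfin; have [[a aX ->] _] := end_compP w Xfin.
move=> /= au uv Xv; apply: linked_trans (au) _.
by apply: linked_adj => //; exact: linked_end au.
Qed.

End Graphs.
Arguments ends : clear implicits.

Section Space.
Variables (R : realType) (G : sgraph).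
Implicit Types (u v : G).

(* The 1-complex of G is given in barycentric coordinates: a point p : G -> R
   is supported on a vertex or on the two endvertices of an edge, and [seg u v t] is
   the point at distance t from u on the edge uv (the vertex u if u = v). *)
Definition seg u v (t : R) : G -> R :=
  fun x => (1 - t) * (x == u)%:R + t * (x == v)%:R.

Definition geom_complex : set (G -> R) :=
  [set p | exists u v t, [/\ u = v \/ adj u v, 0 <= t <= 1 & p = seg u v t]].

(* [curve p q l]: there is a piecewise linear curve of length l from p to q,
   each linear piece of which runs inside one edge. *)
Inductive curve (p : G -> R) : (G -> R) -> R -> Prop :=
| curve_nil : curve p p 0
| curve_cons u v s t l : adj u v -> 0 <= s <= 1 -> 0 <= t <= 1 ->
    curve p (seg u v s) l -> curve p (seg u v t) (l + `|t - s|).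

Definition length_dist (p q : geom_complex) : \bar R :=
  ereal_inf [set l%:E | l in curve (val p) (val q)].

Definition complex_open (O : set geom_complex) :=
  forall p, O p -> exists2 e : R, 0 < e &
    [set q | (length_dist p q < e%:E)%E] `<=` O.

Definition mspace := (geom_complex + ends G)%type.

(* The basic open set \hat C_e(X, w). *)
Definition end_nbhd (X : set G) (w : ends G) (e : R) : set mspace :=
  fun z => match z with
  | inl p =>
      (exists u v t, [/\ end_comp X w u, end_comp X w v, u = v \/ adj u v,
                         0 <= t <= 1 & val p = seg u v t])
      \/ (exists u v t, [/\ end_comp X w u, X v, adj u v,
                            0 <= t < e & val p = seg u v t])
  | inr phi => end_comp X phi = end_comp X w
  end.

Definition mtop_base : set (set mspace) :=
  [set B | (exists2 O, complex_open O & B = inl @` O) \/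
           (exists X w (e : R), [/\ finite_set X, 0 < e < 1 & B = end_nbhd X w e])].

Lemma segC u v t : seg u v t = seg v u (1 - t).
Proof. by apply/funext => x; rewrite /seg subKr addrC. Qed.

Lemma seg0 u v : seg u v 0 = fun x => (x == u)%:R.
Proof. by apply/funext => x; rewrite /seg subr0 mul1r mul0r addr0. Qed.

Lemma seg_l u v t : u != v -> seg u v t u = 1 - t.
Proof. by move=> /negPf uv; rewrite /seg eqxx uv mulr1 mulr0 addr0. Qed.

Lemma seg_r u v t : u != v -> seg u v t v = t.
Proof. by move=> /negPf uv; rewrite /seg eqxx eq_sym uv mulr1 mulr0 add0r. Qed.

Lemma seg_id u t : seg u u t u = 1.
Proof. by rewrite /seg eqxx !mulr1 subrK. Qed.

Lemma seg_out u v t x : x != u -> x != v -> seg u v t x = 0.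
Proof. by rewrite /seg => /negPf -> /negPf ->; rewrite !mulr0 addr0. Qed.

Lemma adj_neq u v : adj u v -> u != v.
Proof. by apply: contraTneq => ->; rewrite adj_irr. Qed.

Lemma curve_lip p q l x : curve p q l -> `|q x - p x| <= l.
Proof.
elim=> [|u v s t l' _ _ _ _ IH]; first by rewrite subrr normr0.
have -> : seg u v t x - p x = (seg u v s x - p x) + (seg u v t x - seg u v s x).
  by rewrite [RHS]addrC addrA subrK.
apply: le_trans (ler_normD _ _) (lerD IH _).
have -> : seg u v t x - seg u v s x = (t - s) * ((x == v)%:R - (x == u)%:R).
  rewrite /seg; lra.
rewrite normrM ler_piMr //.
by case: eqP; case: eqP => _ _; rewrite ?subrr ?subr0 ?sub0r ?normrN ?normr1 ?normr0.
Qed.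

Lemma length_dist_lip (p q : geom_complex) x (e : R) :
  (length_dist p q < e%:E)%E -> `|val q x - val p x| < e.
Proof.
move=> /ereal_inf_lt[_ [l pq <-]]; rewrite lte_fin => /(le_lt_trans _); apply.
exact: curve_lip.
Qed.

Lemma dist_gt (p q : geom_complex) x (e : R) : (length_dist p q < e%:E)%E ->
  val p x - e < val q x.
Proof. move=> /(length_dist_lip x); rewrite ltr_norml; lra. Qed.

Lemma complex_pos (q : geom_complex) x : 0 < val q x ->
  exists v t, [/\ x = v \/ adj x v, 0 <= t <= 1 & val q = seg x v t].
Proof.
have [u [v [t [uv t01 ->]]]] := set_mem (valP q) => qx.
have [xu|xu] := eqVneq x u; first by subst u; exists v, t.
have [xv|xv] := eqVneq x v; last by move: qx; rewrite seg_out // ltxx.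
subst v; exists u, (1 - t); rewrite -segC; split => //; last by lra.
by case: uv => [->|uv]; [left|right; rewrite adj_sym].
Qed.

Lemma end_nbhd_mem1 X w (e : R) (q : geom_complex) u : finite_set X -> 0 < e < 1 ->
  end_comp X w u -> 1 - e < val q u -> end_nbhd X w e (inl q).
Proof.
move=> Xfin e01 uC qu.
have [|v [t [uv t01 eq]]] := @complex_pos q u; first by lra.
have [vC|vC] := pselect (end_comp X w v).
  by left; exists u, v, t.
case: uv => uv; first by rewrite -uv in vC.
right; exists u, v, t; split => //.
  by apply: contrapT => /(end_comp_adj Xfin uC uv).
by move: qu; rewrite eq seg_l ?adj_neq //; lra.
Qed.

Lemma end_nbhd_mem2 X w (e : R) (q : geom_complex) u v : u != v ->
  end_comp X w u -> end_comp X w v -> 0 < val q u -> 0 < val q v ->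
  end_nbhd X w e (inl q).
Proof.
move=> uv uC vC /complex_pos[v' [t [uv' t01 eq]]].
have [e0 _|vv'] := eqVneq v' v.
  by subst v'; left; exists u, v, t.
by rewrite eq seg_out ?ltxx // eq_sym.
Qed.

Lemma end_nbhd_open X w (e : R) : finite_set X -> 0 < e < 1 ->
  complex_open [set p | end_nbhd X w e (inl p)].
Proof.
move=> Xfin e01 p pN.
have near1 u : end_comp X w u -> 1 - e < val p u -> exists2 d : R, 0 < d &
    [set q | (length_dist p q < d%:E)%E] `<=` [set p | end_nbhd X w e (inl p)].
  move=> uC pu; exists (val p u - (1 - e)); first by lra.
  move=> q /= /(dist_gt u) qu; apply: (end_nbhd_mem1 Xfin e01 uC).
  by move: qu; rewrite subKr.
case: pN => [[u [v [t [uC vC uv t01 ep]]]]|[u [v [t [uC vX uv te ep]]]]]; last first.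
  by apply: (near1 u) => //; rewrite ep seg_l ?adj_neq //; lra.
have [euv|nuv] := eqVneq u v.
  by apply: (near1 u) => //; rewrite ep euv seg_id; lra.
have [tlt|tge] := ltP t e.
  by apply: (near1 u) => //; rewrite ep seg_l //; lra.
have [tgt|tle] := ltP (1 - e) t.
  by apply: (near1 v) => //; rewrite ep seg_r //; lra.
exists (Num.min t (1 - t)).
  by rewrite lt_min; apply/andP; split; lra.
move=> q /= qp; have := dist_gt u qp; have := dist_gt v qp.
rewrite ep seg_l // seg_r //.
have : Num.min t (1 - t) <= t by rewrite ge_min lexx.
have : Num.min t (1 - t) <= 1 - t by rewrite ge_min lexx orbT.
move=> h1 h2 h3 h4; apply: (end_nbhd_mem2 e nuv uC vC); lra.
Qed.

Lemma mtop_base_trace B : mtop_base B -> complex_open [set p | B (inl p)].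
Proof.
case=> [[O Oo ->]|[X [w [e [Xfin e01 ->]]]]]; last exact: end_nbhd_open.
move=> p [p' Op' [<-]]; have [e e0 eO] := Oo _ Op'.
by exists e => // q /eO Oq; exists q.
Qed.

Lemma end_nbhdS X Y w w' (d e : R) : finite_set X -> finite_set Y ->
  X `<=` Y -> 0 < d -> d <= e -> e < 1 -> end_comp X w = end_comp X w' ->
  end_nbhd Y w d `<=` end_nbhd X w' e.
Proof.
move=> Xfin Yfin XY d0 de e1 eX.
have sub u : end_comp Y w u -> end_comp X w' u.
  by rewrite -eX; exact: end_compS.
case=> [p|phi] /=; last by move=> /(end_comp_eqS Xfin Yfin XY) ->.
case=> -[u [v [t [/sub uC vC uv t01 ep]]]].
  by left; exists u, v, t; split => //; exact: sub.
have [Xv|Xv] := pselect (X v).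
  by right; exists u, v, t; split => //; lra.
left; exists u, v, t; split => //; last by lra.
  exact: (end_comp_adj Xfin uC uv Xv).
by right.
Qed.

Lemma mtop_base_cover : \bigcup_(B in mtop_base) id B = setT.
Proof.
apply/seteqP; split => // -[p|w] _.
  exists (inl @` setT) => /=; last by exists p.
  by left; exists setT => // q _; exists 1.
exists (end_nbhd set0 w 2^-1) => //=.
by right; exists set0, w, 2^-1; split => //; lra.
Qed.

Lemma mtop_base_join B B' z : mtop_base B -> mtop_base B' -> id B z -> id B' z ->
  exists k, [/\ mtop_base k, id k z & id k `<=` id B `&` id B'].
Proof.
move=> bB bB' /= Bz B'z; case: z => [p|phi] in Bz B'z *.
  exists (inl @` [set p | B (inl p) /\ B' (inl p)]); split.
  - left; eexists; last by [].
    move=> q [/(mtop_base_trace bB)[d d0 dB] /(mtop_base_trace bB')[e e0 eB']].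
    exists (Num.min d e); first by rewrite lt_min d0.
    move=> x /= xq; split; [apply: dB|apply: eB']; apply: lt_le_trans xq _;
      by rewrite lee_fin ge_min lexx ?orbT.
  - by exists p.
  - by move=> _ [q [] Bq B'q <-].
case: bB Bz => [[O _ ->] [//]|[X [w [d [Xfin d01 ->]]]]] /= Xphi.
case: bB' B'z => [[O _ ->] [//]|[X' [w' [e [X'fin e01 ->]]]]] /= X'phi.
have Yfin : finite_set (X `|` X') by rewrite finite_setU.
have m0 : 0 < Num.min d e by rewrite lt_min; apply/andP; split; lra.
have md : Num.min d e <= d by rewrite ge_min lexx.
have me : Num.min d e <= e by rewrite ge_min lexx orbT.
exists (end_nbhd (X `|` X') phi (Num.min d e)); split => //.
  by right; exists (X `|` X'), phi, (Num.min d e); split => //; lra.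
rewrite subsetI; split; apply: end_nbhdS => //; lra.
Qed.

HB.instance Definition _ := Choice.copy mspace (geom_complex + ends G)%type.

HB.instance Definition _ := isBaseTopological.Build mspace
  mtop_base_cover mtop_base_join.

Lemma vertex_complex v : seg v v 0 \in geom_complex.
Proof.
by apply/mem_set; exists v, v, 0; split; [left|rewrite lexx ler01|].
Qed.

Definition vertex_pt v : mspace := inl (exist _ (seg v v 0) (vertex_complex v)).

(* Stages of the Cantor-Bendixson process on the subspace A. *)
Definition cb_derivative (T : topologicalType) (n : nat) (A : set T) : set T :=
  iter n (fun B => B `\` isolated B) A.

Definition slender (U : set G) :=
  exists n, cb_derivative n (closure (vertex_pt @` U)) = set0.

End Space.
Arguments geom_complex : clear implicits.
Arguments mspace : clear implicits.
Arguments slender R {G} U.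

Record tree_decomposition (G : sgraph) := TreeDecomposition {
  td_tree : sgraph;
  td_treeP : is_tree td_tree;
  td_part : td_tree -> set G;
  td_vertex : forall v, exists t, td_part t v;
  td_edge : forall u v, adj u v -> exists t, td_part t u /\ td_part t v;
  td_path : forall t1 t2 t3 s,
    path (@adj td_tree) t1 s -> uniq (t1 :: s) -> last t1 s = t3 ->
    t2 \in t1 :: s -> td_part t1 `&` td_part t3 `<=` td_part t2 }.

Section TreeDecompositions.
Variables (G : sgraph) (D : tree_decomposition G).
Local Notation T := (td_tree D).
Implicit Types (x y t : T) (w : ends G) (eta : ends T).

(* T_x: the component of T - xy that contains x. *)
Definition side x y : set T :=
  [set t | exists2 s,
     path (fun a b => [&& adj a b, (a, b) != (x, y) & (a, b) != (y, x)]) x s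
     & last x s = t].

(* A_x, for the edge xy. *)
Definition side_part x y : set G := \bigcup_(t in side x y) td_part t.

Definition adhesion x y : set G := td_part x `&` td_part y.

Definition finite_adhesion := forall x y, adj x y -> finite_set (adhesion x y).

(* w orients the edge xy of T towards x. *)
Definition oriented_to w x y :=
  is_component (side_part x y `\` adhesion x y) (end_comp (adhesion x y) w).

(* The orientation of T by w points towards a node t if every edge is oriented
   towards the side containing t, and towards an end eta of T if every edge is
   oriented towards the side in which the rays of eta have tails. *)
Definition points_to w (z : T + ends T) :=
  forall x y, adj x y ->
    match z with
    | inl t => side x y t
    | inr eta => forall r, val eta r -> tail_in (side x y) r
    end -> oriented_to w x y.

Definition td_node : T := projT1 (cid (td_treeP D).1.1).

(* The map f of the tree-decomposition, by definite description: if D has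
   finite adhesion, [points_to w] has exactly one element, and the default
   value [td_node] is not used. *)
Definition end_map w : (T + ends T)%type := xget (inl td_node) (points_to w).

Definition distinguishes_ends := injective end_map.

Definition represents_ends := bijective end_map.

Definition at_most_one_ended_parts := forall t w w',
  end_map w = inl t -> end_map w' = inl t -> w = w'.

End TreeDecompositions.

(* Main.v *)
(* (3) => (4): root the tree. The vertices in the parts at distance at most n
   from the root form a slender set, since an end of its closure lives in one of
   these parts and is separated from the parts that are not beyond it by a finite
   adhesion set; so the derivatives remove the ends level by level.

   (4) => (1): build W_0 = {} <= W_1 <= ..., with union V(G), such that every
   component of G - W_n has a finite neighbourhood and contains an end, and exactly
   one end of each component C of G - W_n lives in no component of G - W_(n+1).
   The sets N(C) u (C n W_(n+1)) are then the parts of a tree-decomposition that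
   represents the ends. The extension of W_n inside C is an envelope: a closed set P
   of ends is the set of ends in the closure of a set A such that all components of
   C - A have finite neighbourhoods; A consists of a maximal family of disjoint rays
   of P and the vertices that cannot be separated finitely from these rays. For a
   slender set U, one kind of step separates the ends of the last nonempty derivative
   of the closure of U, a closed discrete set, into distinct components, and the next
   step takes the unique such end in each component as the end of the part. After
   finitely many steps no component contains an end of the closure of U, and U can be
   added to W_n. *)
Require Import Defs.
From mathcomp Require Import all_boot all_order all_algebra.
From mathcomp Require Import all_classical all_reals ereal topology.

Set Implicit Arguments.
Unset Strict Implicit.
Unset Printing Implicit Defensive.

Local Open Scope classical_set_scope.

(** * Sets with finite boundary and the ends living in them *)

Section Regions.
Variable G : sgraph.
Implicit Types (A B D K L X F S : set G) (u v : G) (r : nat -> G) (w : ends G).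

Definition nb K := [set v | ~ K v /\ exists2 u, K u & adj u v].
(* Sets K with finite boundary play the role of the basic open sets C(X, w):
   an end lives in K when the rays of w have tails in K. *)
Definition fbd K := finite_set (nb K).
Definition conn K := forall u v, K u -> K v -> linked K u v.
Definition comp_of A u := [set v | linked A u v].

Lemma comp_refl A u : A u -> comp_of A u u.
Proof. exact: linked_refl. Qed.

Lemma comp_sub A u : comp_of A u `<=` A.
Proof. by move=> v; exact: linked_end. Qed.

Lemma comp_step A u v x : comp_of A u v -> A x -> adj v x -> comp_of A u x.
Proof.
move=> uv Ax vx; apply: (linked_trans uv); apply: linked_adj => //.
exact: linked_end uv.
Qed.

(** The vertex set of a path is connected. This lets [comp_conn] join two vertices of a component by
    a path inside the component. *)
Lemma linked_conn_set A u v : linked A u v ->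
  exists K, [/\ conn K, K `<=` A, K u & K v].
Proof.
move=> [s [ps <- sA]]; exists [set` u :: s]; split => //; last 1 first.
- exact: mem_last.
- elim: s u ps {sA} => [|x s IH] u /=.
    move=> _ a b /=; rewrite !inE => /eqP -> /eqP ->.
    by apply: linked_refl; rewrite /= inE.
  move=> /andP[ux ps].
  have key a : a \in x :: s -> linked [set` u :: x :: s] u a.
    move=> ax; apply: (@linked_trans _ _ _ x).
      by apply: linked_adj => //=; rewrite !inE eqxx ?orbT.
    apply: (@linkedS _ [set` x :: s]).
      by move=> y ys; rewrite /= in_cons; apply/orP; right.
    by apply: IH => //=; rewrite inE eqxx.
  have kk a : a \in u :: x :: s -> linked [set` u :: x :: s] u a.
    rewrite inE => /orP[/eqP ->|/key //].
    by apply: linked_refl => /=; rewrite inE eqxx.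
  by move=> a b /kk ha /kk hb; apply: linked_trans (linked_sym ha) hb.
- exact: mem_head.
Qed.

Lemma conn_sub_comp A K u : conn K -> K `<=` A -> K u -> K `<=` comp_of A u.
Proof. by move=> cK KA Ku v Kv; apply: linkedS KA _; exact: cK. Qed.

Lemma comp_conn A u : conn (comp_of A u).
Proof.
move=> a b ua ub.
have := linked_trans (linked_sym ua) ub.
move=> /linked_conn_set[K [cK KA Ka Kb]].
apply: (@linkedS _ K); last exact: cK.
move=> x Kx; apply: (linked_trans ua); apply: (linkedS KA); exact: cK.
Qed.

Lemma comp_eq A u v : comp_of A u v -> comp_of A v = comp_of A u.
Proof.
move=> uv; apply/seteqP; split => x h; first exact: linked_trans uv h.
exact: linked_trans (linked_sym uv) h.
Qed.

Lemma compS A B u : A `<=` B -> comp_of A u `<=` comp_of B u.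
Proof. by move=> AB v; exact: linkedS. Qed.

Lemma nb_comp A u : nb (comp_of A u) `<=` nb A.
Proof.
move=> v [nv [x ux xv]]; split; last by exists x => //; exact: comp_sub ux.
by move=> Av; apply: nv; exact: comp_step ux Av xv.
Qed.

Lemma fbdS K L : nb K `<=` nb L -> fbd L -> fbd K.
Proof. exact: sub_finite_set. Qed.

Lemma fbd_comp A u : fbd A -> fbd (comp_of A u).
Proof. exact/fbdS/nb_comp. Qed.

Lemma fbdI A B : fbd A -> fbd B -> fbd (A `&` B).
Proof.
move=> fA fB; apply: (@sub_finite_set _ _ (nb A `|` nb B)).
  move=> v [/not_andP[nA|nB] [u [Au Bu] uv]]; [left|right]; split => //; by exists u.
by rewrite finite_setU.
Qed.

Lemma fbdD A F : fbd A -> finite_set F -> fbd (A `\` F).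
Proof.
move=> fA fF; apply: (@sub_finite_set _ _ (nb A `|` F)); last by rewrite finite_setU.
move=> v [h [u [Au Fu] uv]].
have [Fv|Fv] := pselect (F v); [by right|left; split; last by exists u].
by move=> Av; apply: h.
Qed.

Lemma fbd_bigcup I (J : set I) (K : I -> set G) : finite_set J ->
  (forall i, J i -> fbd (K i)) -> fbd (\bigcup_(i in J) K i).
Proof.
move=> fJ fK; apply: (@sub_finite_set _ _ (\bigcup_(i in J) nb (K i))).
  move=> v [nv [u [i Ji Ku] uv]]; exists i => //; split; last by exists u.
  by move=> Kv; apply: nv; exists i.
exact: bigcup_finite.
Qed.

Lemma fbdU A B : fbd A -> fbd B -> fbd (A `|` B).
Proof.
move=> fA fB; apply: (@sub_finite_set _ _ (nb A `|` nb B)); last by rewrite finite_setU.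
by move=> v [/not_orP[nA nB] [u [Au|Bu] uv]]; [left|right]; split => //; exists u.
Qed.

Lemma fbdC X : finite_set X -> fbd (~` X).
Proof. by apply: sub_finite_set => v [/contrapT]. Qed.

Lemma fbdT : fbd setT.
Proof. by apply: (@sub_finite_set _ _ set0) => // v [nv _]; apply: nv. Qed.

(** A path leaving [K] has its first vertex outside [K] in [nb K]. *)
Lemma conn_in E K v : conn E -> E `&` nb K `<=` set0 -> E v -> K v -> E `<=` K.
Proof.
move=> cE EK Ev Kv x Ex; have [s [ps <- sE]] := cE _ _ Ev Ex.
elim: s v Ev Kv ps sE => [//|y s IH] v Ev Kv /= /andP[vy ps] sE.
have Ey : E y by apply: sE; rewrite /= !inE eqxx orbT.
apply: IH => //; last by move=> z zs; apply: sE; rewrite /= inE zs orbT.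
apply: contrapT => Ky; apply: (EK y); split => //; split => //; by exists v.
Qed.

Lemma tail_inS A B r : A `<=` B -> tail_in A r -> tail_in B r.
Proof. by move=> AB [n h]; exists n => m /h; exact: AB. Qed.

Lemma tail_inI A B r : tail_in A r -> tail_in B r -> tail_in (A `&` B) r.
Proof.
move=> [n hn] [m hm]; exists (maxn n m) => k; rewrite geq_max => /andP[nk mk].
by split; [exact: hn|exact: hm].
Qed.

Lemma tail_in0 A r : tail_in A r -> exists n, A (r n).
Proof. by move=> [n h]; exists n; exact: h. Qed.

Lemma tail_comp A r : is_ray r -> tail_in A r -> exists u, A u /\ tail_in (comp_of A u) r.
Proof.
move=> rr [n h]; exists (r n); split; first exact: h.
by exists n => m nm; exact: ray_linked.
Qed.

(** Once the ray has left the finite set [nb K] for good, it can no longer pass between [K] and its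
    complement. *)
Lemma tail_dich K r : is_ray r -> fbd K -> tail_in K r \/ tail_in (~` (K `|` nb K)) r.
Proof.
move=> rr fK; have [n h] := ray_avoids rr fK.
have [Kn|Kn] := pselect (K (r n)); [left|right]; exists n.
  elim=> [|m IH]; first by rewrite leqn0 => /eqP <-.
  rewrite leq_eqVlt => /orP[/eqP <-//|nm]; apply: contrapT => Km.
  by apply: (h m.+1 (ltnW nm)); split => //; exists (r m); [exact: IH|exact: rr.2].
suff H m : (n <= m)%N -> ~ K (r m) by move=> m nm [/(H m nm)|/(h m nm)].
elim: m => [|m IH]; first by rewrite leqn0 => /eqP <-.
rewrite leq_eqVlt => /orP[/eqP <-//|nm] Km.
apply: (h m nm); split; first exact: IH.
by exists (r m.+1) => //; rewrite adj_sym; exact: rr.2.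
Qed.

Definition end_of r (rr : is_ray r) : ends G :=
  exist _ [set r' | is_ray r' /\ ray_equiv r r'] (mem_set (ex_intro2 _ _ r rr erefl)).

Lemma end_of_mem r (rr : is_ray r) : val (end_of rr) r.
Proof. by split => //; exact: ray_equiv_refl. Qed.

Definition lives K w := exists2 r, val w r & tail_in K r.

(** For finite boundary, [lives] does not depend on the ray: the component of G - [nb K] in which w
    lives meets [K], hence lies in [K], and it holds a tail of every ray of w. *)
Lemma livesP K w r : fbd K -> lives K w -> val w r -> tail_in K r.
Proof.
move=> fK [r0 wr0 t0] wr.
have [[u uX eC] tC] := end_compP w fK.
have [n [Kn Cn]] := tail_in0 (tail_inI t0 (tC _ wr0)).
have cC : conn (end_comp (nb K) w) by rewrite eC; exact: comp_conn.
apply: tail_inS (tC _ wr); apply: (conn_in cC) Cn Kn.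
by move=> v [] /=; rewrite eC => /comp_sub.
Qed.

Lemma livesS K L w : K `<=` L -> lives K w -> lives L w.
Proof. by move=> KL [r wr t]; exists r => //; exact: tail_inS t. Qed.

Lemma livesI K L w : fbd K -> lives K w -> lives L w -> lives (K `&` L) w.
Proof.
move=> fK lK [r wr tL]; exists r => //; apply: tail_inI tL; exact: livesP lK wr.
Qed.

Lemma livesC X w : finite_set X -> lives (~` X) w.
Proof.
move=> fX; have [r wr] := end_nonempty w; exists r => //.
exact: ray_avoids (end_ray wr) fX.
Qed.

Lemma livesD K F w : fbd K -> finite_set F -> lives K w -> lives (K `\` F) w.
Proof. by move=> fK fF lK; apply: livesI => //; exact: livesC. Qed.

Lemma lives_comp K w : lives K w -> exists2 u, K u & lives (comp_of K u) w.
Proof.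
move=> [r wr t]; have [u [Ku tu]] := tail_comp (end_ray wr) t.
by exists u => //; exists r.
Qed.

Lemma lives_nonempty K w : lives K w -> K !=set0.
Proof. by move=> [r _ /tail_in0[n]]; exists (r n). Qed.

Lemma livesT w : lives setT w.
Proof. by have [r wr] := end_nonempty w; exists r => //; exists 0%N. Qed.

Lemma not_lives K w : fbd K -> ~ lives K w -> lives (~` (K `|` nb K)) w.
Proof.
move=> fK nl; have [r wr] := end_nonempty w.
have [t|t] := tail_dich (end_ray wr) fK; last by exists r.
by case: nl; exists r.
Qed.

Lemma lives_ext K L w : fbd K -> lives K w -> lives L w -> K `&` L !=set0.
Proof. by move=> fK lK lL; exact: lives_nonempty (livesI fK lK lL). Qed.

Lemma ends_eq_ray w w' r : val w r -> val w' r -> w = w'.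
Proof.
move=> wr w'r; apply/val_inj/seteqP.
suff H (x y : ends G) : val x r -> val y r -> val x `<=` val y by split; exact: H.
move=> {w w' wr w'r} xr yr r' xr'.
have := set_mem (valP y) => -[r0 rr0 ey].
rewrite ey; split; first exact: end_ray xr'.
move=> X fX sep.
have [_ tC] := end_compP y fX.
have [[ux uxX eCx] tCx] := end_compP x fX.
have [[uy uyX eCy] _] := end_compP y fX.
have yr0 : val y r0 by rewrite ey; split => //; exact: ray_equiv_refl.
have [n nh] := tC _ yr0; have [m mh] := tCx _ xr'.
have [a [xa ya]] := tail_in0 (tail_inI (tCx _ xr) (tC _ yr)).
have e : end_comp X x = end_comp X y.
  by apply: (component_eq (end_compP x fX).1 (end_compP y fX).1 xa ya).
have := nh n (leqnn _); have := mh m (leqnn _); rewrite e eCy /= => h1 h2.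
have [s [ps ls sX]] := linked_trans (linked_sym h2) h1.
have [| |z [zs Xz]] := sep _ _ _ ps _.
- by exists n.
- by rewrite ls; exists m.
- exact: sX zs Xz.
Qed.

(** A finite X cannot separate a ray of w from a ray of w': the component of G - X with a tail of
    the former has finite boundary, so w' lives in it as well. *)
Lemma ends_eq w w' : (forall K, fbd K -> lives K w -> lives K w') -> w = w'.
Proof.
move=> H; have [r wr] := end_nonempty w; have [r' wr'] := end_nonempty w'.
apply: (ends_eq_ray (r := r')) => //.
have := set_mem (valP w) => -[r0 rr0 ew].
rewrite ew; split; first exact: end_ray wr'.
have wr0 : val w r0 by rewrite ew; split => //; exact: ray_equiv_refl.
move=> X fX sep.
have [a [_ ta]] := tail_comp rr0 (ray_avoids rr0 fX).
have ta' : tail_in (comp_of (~` X) a) r'.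
  apply: livesP wr'; first exact/fbd_comp/fbdC.
  by apply: H; [exact/fbd_comp/fbdC|exists r0].
have [n h1] := tail_in0 ta; have [m h2] := tail_in0 ta'.
have [s [ps ls sX]] := linked_trans (linked_sym h1) h2.
have [| |z [zs Xz]] := sep _ _ _ ps _.
- by exists n.
- by rewrite ls; exists m.
- exact: sX zs Xz.
Qed.

Lemma ends_sep w w' : w <> w' ->
  exists K, [/\ fbd K, lives K w & ~ lives K w'].
Proof.
move=> ne; apply: contrapT => h; apply: ne; apply: ends_eq => K fK lK.
by apply: contrapT => nl; apply: h; exists K.
Qed.

(* w lies in the closure of A. *)
Definition sticks A w := forall K, fbd K -> lives K w -> K `&` A !=set0.

Lemma not_sticks A w : ~ sticks A w -> exists K, [/\ fbd K, lives K w & K `&` A = set0].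
Proof.
move=> /existsNP[K /not_implyP[fK /not_implyP[lK /nonemptyPn h]]].
by exists K; split.
Qed.

End Regions.

Lemma ex_minimal (P : nat -> Prop) : (exists n, P n) ->
  exists2 n, P n & forall m, P m -> (n <= m)%N.
Proof.
move=> [n Pn]; have ex : exists n, `[< P n >] by exists n; apply/asboolP.
case: (ex_minnP ex) => k /asboolP Pk kmin; exists k => // m Pm.
exact/kmin/asboolP.
Qed.

(** * Rays through a decreasing sequence of connected sets *)

Section Escape.
Variables (G : sgraph) (E : nat -> set G).

(* Let [h x] be the largest n with [E n x] and [d x] the distance inside
   [E (h x)] from x to [E (h x).+1]. A walk that always moves to a neighbour
   with larger h, or with the same h and smaller d, never returns. *)
Lemma escape_ray : (forall n, E n.+1 `<=` E n) -> (forall n, conn (E n)) ->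
  (forall n, E n !=set0) -> (forall v, exists n, ~ E n v) ->
  exists r, [/\ is_ray r, forall k, E 0%N (r k) & forall n, tail_in (E n) r].
Proof.
move=> Edec Ec Ene Ecap.
have Emon m n : (n <= m)%N -> E m `<=` E n.
  elim: m => [|m IH]; first by rewrite leqn0 => /eqP ->.
  rewrite leq_eqVlt => /orP[/eqP ->//|nm].
  exact: subset_trans (Edec m) (IH nm).
have /choice[h hP] : forall x, exists n, E 0%N x -> E n x /\ ~ E n.+1 x.
  move=> x; have [n nE] := Ecap x.
  have [E0|nE0] := pselect (E 0%N x); last by exists 0%N.
  have [k kE kmin] := @ex_minimal (fun n => ~ E n x) (ex_intro _ n nE).
  case: k kE kmin => [//|k] kE kmin; exists k => _; split => //.
  by apply: contrapT => /kmin; rewrite ltnn.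
have hE n x : E n x -> (n <= h x)%N.
  move=> Enx; rewrite leqNgt; apply/negP => lt.
  have [|_] := hP x; first exact: Emon Enx.
  by apply; exact: Emon Enx.
pose Pd x k := exists s, [/\ path (@adj G) x s, size s = k,
  [set` x :: s] `<=` E (h x) & E (h x).+1 (last x s)].
have /choice[d dP] : forall x, exists k, E 0%N x -> Pd x k /\ forall m, Pd x m -> (k <= m)%N.
  move=> x; have [E0|nE0] := pselect (E 0%N x); last by exists 0%N.
  have [u Eu] := Ene (h x).+1.
  have [s [ps ls sE]] := Ec (h x) x u (hP x E0).1 (Edec _ _ Eu).
  have [|k kP kmin] := @ex_minimal (Pd x); last by exists k.
  by exists (size s), s; rewrite ls.
pose L x y := (h x < h y)%N \/ (h x = h y /\ (d y < d x)%N).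
have /choice[f fP] : forall x, exists y, E 0%N x -> [/\ E 0%N y, adj x y & L x y].
  move=> x; have [E0|nE0] := pselect (E 0%N x); last by exists x.
  have [[[|y s] [/= ps sk sE ls]] kmin] := dP x E0; first by case: (hP x E0).
  move/andP: ps => [xy ps].
  have Ey : E (h x) y by apply: sE; rewrite /= !inE eqxx orbT.
  have E0y : E 0%N y by exact: Emon Ey.
  exists y => _; split => //.
  have := hE _ _ Ey; rewrite leq_eqVlt => /orP[/eqP e|]; [right|by left].
  split => //; rewrite -sk ltnS.
  have [_ ymin] := dP y E0y.
  apply: ymin; exists s; split => //; rewrite -e //.
  by move=> z zs; apply: sE; rewrite /= in_cons; apply/orP; right.
have [x0 Ex0] := Ene 0%N.
pose r n := iter n f x0.
have r0 k : E 0%N (r k) by elim: k => [//|k IH] /=; case: (fP _ IH).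
have rS k : L (r k) (r k.+1) by case: (fP _ (r0 k)).
have Ltr x y z : L x y -> L y z -> L x z.
  rewrite /L => -[xy|[xy dxy]] -[yz|[yz dyz]].
  - by left; exact: ltn_trans xy yz.
  - by left; rewrite -yz.
  - by left; rewrite xy.
  - by right; rewrite xy; split => //; exact: ltn_trans dyz dxy.
have rL i j : (i < j)%N -> L (r i) (r j).
  elim: j => [//|j IH]; rewrite ltnS leq_eqVlt => /orP[/eqP ->//|/IH ij].
  exact: Ltr ij (rS j).
have Lirr x : ~ L x x by rewrite /L !ltnn => -[//|[]].
have rinj : injective r.
  move=> i j e; case: (ltngtP i j) => // /rL; rewrite e => /Lirr //.
exists r; split => //.
  by split => // n; case: (fP _ (r0 n)).
(* While h is constant along r, d strictly decreases, so h must grow eventually. *)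
have hup m k : (d (r k) <= m)%N -> exists k', (h (r k) < h (r k'))%N.
  elim: m k => [|m IH] k dm; case: (rS k) => [lt|[e lt]]; try by exists k.+1.
    by move: lt; rewrite ltnNge (leq_trans dm).
  by rewrite e; apply: IH; rewrite -ltnS; exact: leq_trans lt dm.
have hub n : exists k, (n <= h (r k))%N.
  elim: n => [|n [k nk]]; first by exists 0%N.
  by have [k' kk'] := hup _ k (leqnn _); exists k'; exact: leq_ltn_trans nk kk'.
move=> n; have [k nk] := hub n; exists k => m; rewrite leq_eqVlt => /orP[/eqP <-|km].
  by apply: Emon nk _ _; case: (hP _ (r0 k)).
have hh : (h (r k) <= h (r m))%N by case: (rL _ _ km) => [/ltnW|[->]].
by apply: (Emon (h (r m))); [exact: leq_trans nk hh|case: (hP _ (r0 m))].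
Qed.

End Escape.

Lemma dep_choice (T : Type) (P : nat -> T -> Prop) (Q : nat -> T -> T -> Prop) :
  (exists x, P 0%N x) -> (forall n x, P n x -> exists y, P n.+1 y /\ Q n x y) ->
  exists f, forall n, P n (f n) /\ Q n (f n) (f n.+1).
Proof.
move=> [x0 Px0] H.
have /choice[g gP] : forall p : nat * T, exists y, P p.1 p.2 -> P p.1.+1 y /\ Q p.1 p.2 y.
  move=> [n x]; have [Px|Px] := pselect (P n x); last by exists x.
  by have [y yP] := H _ _ Px; exists y.
pose f := fix f n := if n is m.+1 then g (m, f m) else x0.
have fP n : P n (f n) by elim: n => [//|n IH]; case: (gP (n, f n) IH).
by exists f => n; split => //; case: (gP (n, f n) (fP n)).
Qed.

Lemma finite_subset1 (T : Type) (A : set T) : is_subset1 A -> finite_set A.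
Proof.
move=> h; have [->|/set0P[x Ax]] := eqVneq A set0; first exact: finite_set0.
by apply: (@sub_finite_set _ _ [set x]) => // y Ay; exact: h.
Qed.

(** * Envelopes *)

Section Envelope.
Variable G : sgraph.
Implicit Types (A B D K L X F S : set G) (u v : G) (r : nat -> G) (w : ends G).

(* A together with the vertices of D that finitely many vertices cannot separate
   from A. *)
Definition dcl D A := [set v | D v /\ forall K, fbd K -> K v -> K `&` A !=set0].

Lemma sub_dcl D A : A `<=` D -> A `<=` dcl D A.
Proof. by move=> AD v Av; split; [exact: AD|move=> K _ Kv; exists v]. Qed.

Lemma dcl_disj D A K : fbd K -> K `&` A = set0 -> K `&` dcl D A = set0.
Proof.
move=> fK KA; apply/seteqP; split => // v [Kv [_ /(_ K fK Kv)]].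
by rewrite KA => -[].
Qed.

Lemma setI0_disj (T : Type) (X Y : set T) x : X `&` Y = set0 -> X x -> Y x -> False.
Proof. by move=> e Xx Yx; have : (X `&` Y) x by []; rewrite e. Qed.

Lemma dcl_out D A v : D v -> ~ dcl D A v -> exists K, [/\ fbd K, K v & K `&` A = set0].
Proof.
move=> Dv h; apply: contrapT => h'; apply: h; split => // K fK Kv.
by apply/set0P/negP => /eqP e; apply: h'; exists K.
Qed.

(** Walk inside [E] from x towards v; y is the last vertex before the walk first enters [L]. *)
Lemma exit_path L E v x : conn E -> E v -> L v -> E x -> ~ L x ->
  exists y, [/\ nb L y, E y, ~ L y & comp_of (E `\` L) x y].
Proof.
move=> cE Ev Lv Ex Lx; have [s [ps ls sE]] := cE _ _ Ex Ev.
elim: s x Ex Lx ps ls sE => [|y s IH] x Ex Lx /=.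
  by move=> _ e; rewrite e in Lx.
move=> /andP[xy ps] ls sE.
have [Ly|Ly] := pselect (L y).
  exists x; split => //; last exact: comp_refl.
  by split => //; exists y => //; rewrite adj_sym.
have Ey : E y by apply: sE; rewrite /= !inE eqxx orbT.
have [|z [nz Ez Lz cz]] := IH y Ey Ly ps ls.
  by move=> z zs; apply: sE; rewrite /= in_cons; apply/orP; right.
by exists z; split => //; apply: linked_trans cz; exact: linked_adj.
Qed.

(* If the component has infinitely many neighbours, exhaust it by sets L n with
   finite boundary and follow components of what remains that still have
   infinitely many neighbours outside. *)
Lemma dcl_comp_ray D A u : fbd D -> (D `\` dcl D A) u ->
  ~ fbd (comp_of (D `\` dcl D A) u) ->
  exists r, [/\ is_ray r, forall k, comp_of (D `\` dcl D A) u (r k) &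
    forall K, fbd K -> tail_in K r -> K `&` A !=set0].
Proof.
move=> fD Ou; set O := D `\` dcl D A in Ou *; set C := comp_of O u => ninf.
have Cc : conn C := @comp_conn _ _ _.
have CO : C `<=` O := @comp_sub _ _ _.
have inC K v : fbd K -> K `&` A = set0 -> C v -> K v ->
    [/\ fbd (comp_of (K `&` D) v), comp_of (K `&` D) v `<=` C & comp_of (K `&` D) v v].
  move=> fK KA Cv Kv; have [Dv _] := CO _ Cv.
  split; [exact/fbd_comp/fbdI| |exact: comp_refl].
  rewrite /C -(comp_eq Cv); apply: compS => x [Kx Dx]; split => // dx.
  exact: setI0_disj (dcl_disj D fK KA) Kx dx.
have /choice[k kP] : forall v, exists K, C v -> [/\ fbd K, K `<=` C & K v].
  move=> v; have [Cv|Cv] := pselect (C v); last by exists set0.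
  have [Dv dv] := CO _ Cv; have [K [fK Kv KA]] := dcl_out Dv dv.
  by exists (comp_of (K `&` D) v) => _; exact: inC.
(* These sets exhaust C: every stage adds a set of finite boundary around each of the finitely many
   boundary vertices in C. *)
pose L := fix L n := if n is m.+1 then L m `|` \bigcup_(v in nb (L m) `&` C) k v else k u.
have Cu : C u by exact: comp_refl.
have LP n : fbd (L n) /\ L n `<=` C.
  elim: n => [|n [IH1 IH2]] /=; first by have [] := kP _ Cu.
  split; last first.
    by move=> x [/IH2//|[v [_ Cv] kx]]; have [_ h _] := kP _ Cv; exact: h.
  apply: fbdU => //; apply: fbd_bigcup; first exact: finite_setIl.
  by move=> v [_ Cv]; have [] := kP _ Cv.
have Lmon m n : (m <= n)%N -> L m `<=` L n.
  elim: n => [|n IH]; first by rewrite leqn0 => /eqP ->.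
  rewrite leq_eqVlt => /orP[/eqP ->//|mn].
  by apply: subset_trans (IH mn) _ => x; left.
have Lcup v : C v -> exists n, L n v.
  move=> Cv; have [s [ps <- sC]] := Cc _ _ Cu Cv.
  have : exists n, L n u by exists 0%N; have [] := kP _ Cu.
  elim: s (u) ps sC {Cu} => [//|y s IH] x /= /andP[xy ps] sC [n Lx].
  have Cy : C y by apply: sC; rewrite /= !inE eqxx orbT.
  apply: IH => //.
    by move=> z zs; apply: sC; rewrite /= in_cons; apply/orP; right.
  exists n.+1 => /=; have [Ly|Ly] := pselect (L n y); [by left|right].
  exists y; last by have [] := kP _ Cy.
  by split => //; split => //; exists x.
pose big E := ~ finite_set (nb E `\` C).
(* If E meets [L n], a neighbour of E outside C is a neighbour of [L n] or of a component of E minus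
   [L n] that meets [nb (L n)]. There are finitely many such components, so one of them is big. *)
have bigS E n : conn E -> E `<=` C -> big E ->
    exists E', [/\ conn E', E' `<=` C `\` L n, big E' & E' `<=` E].
  move=> cE EC bE; have [[v [Ev Lv]]|h] := pselect (exists v, E v /\ L n v); last first.
    exists E; split => // x Ex; split; first exact: EC.
    by move=> Lx; apply: h; exists x.
  apply: contrapT => nE; apply: bE.
  apply: (@sub_finite_set _ _ (nb (L n) `|`
     \bigcup_(x in nb (L n) `&` (E `\` L n)) (nb (comp_of (E `\` L n) x) `\` C))); last first.
    rewrite finite_setU; split; first exact: (LP n).1.
    apply: bigcup_finite; first exact/finite_setIl/(LP n).1.
    move=> x [_ [Ex Lx]]; apply: contrapT => bx; apply: nE.
    exists (comp_of (E `\` L n) x); split => //; first exact: comp_conn.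
      by move=> y /comp_sub[/EC].
    by move=> y /comp_sub[].
  move=> y [[Ey [x Ex xy]] Cy].
  have [Lx|Lx] := pselect (L n x).
    by left; split; [move=> /(LP n).2|exists x].
  have [z [nz Ez Lz cz]] := exit_path cE Ev Lv Ex Lx.
  right; exists z => //; split => //; split; first by move=> /comp_sub[/EC].
  by exists x => //; exact: linked_sym.
have [E EP] : exists E, forall n, (conn (E n) /\ E n `<=` C `\` L n /\ big (E n)) /\
    E n.+1 `<=` E n.
  apply: (@dep_choice _ (fun n E => conn E /\ E `<=` C `\` L n /\ big E)
    (fun _ E E' => E' `<=` E)).
    have [|E [? ? ? ?]] := @bigS C 0%N Cc (@subset_refl _ _); last by exists E.
    move=> h; apply: ninf; apply: sub_finite_set h.
    by move=> v nv; split => //; case: nv.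
  move=> n E [cE [EC bE]].
  have [|E' [? ? ? ?]] := @bigS E n.+1 cE _ bE; last by exists E'.
  by move=> x /EC[].
have [|||v|r [rr r0 rE]] := @escape_ray G E.
- by move=> n; case: (EP n).
- by move=> n; case: (EP n) => -[].
- move=> n; apply/set0P/negP => /eqP e; case: (EP n) => -[_ [_]] + _.
  by apply; apply: (@sub_finite_set _ _ set0) => // y [[_ [x]]]; rewrite e.
- have [Cv|Cv] := pselect (C v); last first.
    by exists 0%N => Ev; case: (EP 0%N) => -[_ [/(_ _ Ev)[]]].
  have [n Ln] := Lcup _ Cv; exists n => Ev.
  by case: (EP n) => -[_ [/(_ _ Ev)[]]].
have rC i : C (r i) by case: (EP 0%N) => -[_ [/(_ _ (r0 i))[]]].
(* If K missed A, a component K' of K in D would hold a tail of r and lie in C. For large n its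
   boundary inside C lies in [L n], so [E n] is trapped in K' and cannot be big. *)
exists r; split => // K fK tK; apply/set0P/negP => /eqP KA.
have tKD : tail_in (K `&` D) r.
  by apply: tail_inI => //; exists 0%N => m _; case: (CO _ (rC m)).
have [x [[Kx Dx] tx]] := tail_comp rr tKD.
have Cx : C x.
  have [m xm] := tail_in0 tx; have := linked_trans (rC m : linked O u (r m)) (linked_sym _).
  apply; apply: linkedS xm => y [Ky Dy]; split => // dy.
  exact: setI0_disj (dcl_disj D fK KA) Ky dy.
have [fK' K'C _] := inC _ _ fK KA Cx Kx.
set K' := comp_of _ _ in tx fK' K'C.
have [n hn] : exists n, nb K' `&` C `<=` L n.
  have /choice[g gP] : forall v, exists n, C v -> L n v.
    move=> v; have [Cv|Cv] := pselect (C v); last by exists 0%N.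
    by have [n Ln] := Lcup _ Cv; exists n.
  have /finite_fsetP[Y eY] : finite_set (nb K' `&` C) by exact: finite_setIl.
  exists (\max_(v <- finmap.enum_fset Y) g v) => v vK.
  apply: (@Lmon (g v)); last by apply: gP; case: vK.
  by move: vK; rewrite eY => vY; apply: (@leq_bigmax_seq _ _ xpredT g).
have [[cE [EC bE]] _] := EP n.
have [m [Em Km]] := tail_in0 (tail_inI (rE n) tx).
have EK : E n `<=` K'.
  by apply: (conn_in cE) Em Km => y [/EC[Cy Ly] ny]; exact/Ly/hn.
apply: bE; apply: sub_finite_set fK' => y [[_ [z Ez zy]] Cy].
by split; [move=> /K'C|exists z => //; exact: EK].
Qed.

(** Zorn's lemma for families of disjoint rays in D of ends in P; the last clause expresses
    maximality. *)
Lemma max_rays D (P : set (ends G)) : exists RR : set (nat -> G), [/\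
  forall R, RR R -> [/\ is_ray R, forall k, D (R k) & exists2 w, P w & val w R],
  forall R R' m n, RR R -> RR R' -> R m = R' n -> R = R' &
  forall r w, (forall k, D (r k)) -> P w -> val w r ->
    exists R m n, RR R /\ R m = r n].
Proof.
pose ok R := [/\ is_ray R, forall k, D (R k) & exists2 w, P w & val w R].
pose Q := [set RR : set (nat -> G) | (forall R, RR R -> ok R) /\
  forall R R' m n, RR R -> RR R' -> R m = R' n -> R = R'].
have [F FQ Ftot|RR [[RRok RRd] RRmax]] := @Zorn_bigcup _ Q.
  split; first by move=> R [X FX XR]; case: (FQ _ FX) => h _; exact: h.
  move=> R R' m n [X FX XR] [X' FX' XR'].
  have [XX'|X'X] := Ftot _ _ FX FX'.
    by case: (FQ _ FX') => _; apply => //; exact: XX'.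
  by case: (FQ _ FX) => _; apply => //; exact: X'X.
exists RR; split => // r w rD Pw wr; apply: contrapT => nm.
have rr := end_ray wr.
apply: (RRmax (RR `|` [set r])).
  split; first by move=> X; left.
  move=> /(_ r (or_intror erefl)) RRr; apply: nm; by exists r, 0%N, 0%N.
split; first by move=> R [/RRok//|->]; split => //; exists w.
move=> R R' m n [RRR|->] [RRR'|->] e //.
- exact: RRd e.
- by case: nm; exists R, m, n.
- by case: nm; exists R', n, m.
Qed.

Lemma meet_nb K R n : is_ray R -> K (R n) -> ~ tail_in K R -> exists m, nb K (R m).
Proof.
move=> rR Kn nt; apply: contrapT => h; apply: nt; exists n.
elim=> [|m IH]; first by rewrite leqn0 => /eqP <-.
rewrite leq_eqVlt => /orP[/eqP <-//|nm]; apply: contrapT => Km; apply: h.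
by exists m.+1; split => //; exists (R m); [exact: IH|exact: rR.2].
Qed.

(** A ray that meets K without having a tail in K crosses [nb K]. By disjointness there are finitely
    many such rays, and each has only finitely many vertices in K. *)
Lemma finite_escaping K (RR : set (nat -> G)) : fbd K ->
  (forall R, RR R -> is_ray R) ->
  (forall R R' m n, RR R -> RR R' -> R m = R' n -> R = R') ->
  finite_set [set v | K v /\ exists R n, [/\ RR R, R n = v & ~ tail_in K R]].
Proof.
move=> fK RRr RRd.
apply: (@sub_finite_set _ _ (\bigcup_(x in nb K)
  \bigcup_(R in [set R | RR R /\ ~ tail_in K R /\ exists n, R n = x]) (range R `&` K))).
  move=> v [Kv [R [n [RRR Rn nt]]]].
  rewrite -Rn in Kv; have [m nm] := meet_nb (RRr _ RRR) Kv nt.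
  exists (R m) => //; exists R; first by split => //; split => //; exists m.
  by rewrite -Rn; split => //; exists n.
apply: bigcup_finite => // x nx; apply: bigcup_finite.
  apply: finite_subset1 => R R' [RRR [_ [n e]]] [RRR' [_ [n' e']]].
  by apply: (RRd _ _ n n') => //; rewrite e e'.
move=> R [RRR [nt _]]; have [//|[n tn]] := tail_dich (RRr _ RRR) fK.
apply: (@sub_finite_set _ _ (R @` `I_n)); last exact/finite_image/finite_II.
move=> _ [[i _ <-] Ki]; exists i => //=; rewrite ltnNge; apply/negP => /tn.
by apply; left.
Qed.

(** Closedness relative to the ends living in D; the members of P may live elsewhere. *)
Definition closed_in D (P : set (ends G)) := forall w, lives D w -> ~ P w ->
  exists K, [/\ fbd K, lives K w & forall w', P w' -> ~ lives K w'].

Definition dispersed_in D S := forall w, lives D w -> ~ sticks S w.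

Definition rays_cover (RR : set (nat -> G)) := [set v | exists R n, RR R /\ R n = v].

Lemma lives_range D r w : fbd D -> lives D w -> val w r -> exists n,
  forall k, D (r (n + k)%N).
Proof.
move=> fD lD wr; have [n h] := livesP fD lD wr; exists n => k.
exact/h/leq_addr.
Qed.

Lemma ray_shift r n : is_ray r -> is_ray (fun k => r (n + k)%N).
Proof.
move=> [ri ra]; split; first by move=> i j /ri/addnI.
by move=> k; rewrite addnS; exact: ra.
Qed.

Lemma tail_shift A r n : tail_in A (fun k => r (n + k)%N) <-> tail_in A r.
Proof.
split=> -[m h].
  exists (n + m)%N => k nmk; have := h (k - n)%N.
  have nk : (n <= k)%N by exact: leq_trans (leq_addr _ _) nmk.
  by rewrite subnKC //; apply; rewrite leq_subRL.
by exists m => k mk; apply/h/(leq_trans mk)/leq_addl.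
Qed.

Lemma end_eq_ray r (rr : is_ray r) w : (forall K, fbd K -> tail_in K r -> lives K w) ->
  w = end_of rr.
Proof.
move=> h; apply/esym/ends_eq => K fK lK; apply: h => //.
exact: livesP (end_of_mem rr).
Qed.

Lemma lives_end_of K r (rr : is_ray r) : fbd K -> lives K (end_of rr) <-> tail_in K r.
Proof.
by move=> fK; split=> [lK|]; [exact: livesP (end_of_mem rr)|exists r => //; exact: end_of_mem].
Qed.

Lemma end_mem w r : is_ray r -> (forall K, fbd K -> tail_in K r -> lives K w) -> val w r.
Proof. by move=> rr h; rewrite (end_eq_ray rr h); exact: end_of_mem. Qed.

Lemma val_shift w r n : val w r -> val w (fun k => r (n + k)%N).
Proof.
move=> wr; apply: end_mem; first exact/ray_shift/end_ray/wr.
by move=> K fK /tail_shift t; exists r.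
Qed.

Section RayCover.
Variables (D S : set G) (P : set (ends G)) (RR : set (nat -> G)).
Hypotheses (fD : fbd D) (SD : S `<=` D).
Hypothesis RRok : forall R, RR R -> [/\ is_ray R, forall k, D (R k) & exists2 w, P w & val w R].
Hypothesis RRdisj : forall R R' m n, RR R -> RR R' -> R m = R' n -> R = R'.
Hypothesis RRmax : forall r w, (forall k, D (r k)) -> P w -> val w r ->
    exists R m n, RR R /\ R m = r n.
Hypotheses (Sdisp : dispersed_in D S) (Pcl : closed_in D P).
Local Notation A := (S `|` rays_cover RR).

Lemma rays_coverD : rays_cover RR `<=` D.
Proof. by move=> v [R [n [/RRok[_ h _] <-]]]. Qed.

(* An end outside P has a region K with no end of P, so only the finitely many
   disjoint rays that cross the boundary of K meet K, each in a finite set. *)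
Lemma sticks_cover w : lives D w -> sticks A w -> P w.
Proof.
move=> lD st; apply: contrapT => nP.
have [K [fK lK KP]] := Pcl lD nP.
have [K' [fK' lK' K'S]] := not_sticks (Sdisp lD).
have fKK : fbd (K `&` K') by exact: fbdI.
have lKK : lives (K `&` K') w by exact: livesI.
have fin := finite_escaping fKK (fun R h => let: And3 a _ _ := RRok h in a) RRdisj.
have [v [[[Kv K'v] nv] [Sv|[R [n [RRR Rn]]]]]] := st _ (fbdD fKK fin) (livesD fKK fin lKK).
  exact: setI0_disj K'S K'v Sv.
apply: nv; split => //; exists R, n; split => // t.
have [_ _ [w' Pw' w'R]] := RRok RRR.
by apply: (KP w' Pw'); exists R => //; apply: tail_inS t => x [].
Qed.

(** Taking [dcl] adds no end to the closure. Conversely, a ray of an end in P has a tail in K and D,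
    and this tail meets the family of rays by maximality. *)
Lemma sticks_dcl w : lives D w -> sticks (dcl D A) w <-> P w.
Proof.
move=> lD; split => [st|Pw].
  apply: sticks_cover => // K fK lK; apply/set0P/negP => /eqP /(dcl_disj D fK) e.
  by have [x] := st _ fK lK; rewrite e.
suff st : sticks A w.
  move=> K fK lK; have [x [[Kx Dx] Ax]] := st _ (fbdI fK fD) (livesI fK lK lD).
  by exists x; split => //; apply: sub_dcl => // y [/SD|/rays_coverD].
move=> K fK lK; have [r wr] := end_nonempty w.
have [n h] := lives_range (fbdI fK fD) (livesI fK lK lD) wr.
have [|R [i [j [RRR e]]]] := RRmax _ Pw (val_shift n wr).
  by move=> k; case: (h k).
exists (r (n + j)%N); split; first by case: (h j).
by right; exists R, i.
Qed.

(** A component of infinite boundary would contain a ray whose end is in the closure of A, hence in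
    P. By maximality this ray would meet the family and thus [dcl D A]. *)
Lemma fbd_dcl_comp u : (D `\` dcl D A) u -> fbd (comp_of (D `\` dcl D A) u).
Proof.
move=> Ou; apply: contrapT => nf.
have [r [rr rC st]] := dcl_comp_ray fD Ou nf.
have rD k : D (r k) by case: (comp_sub (rC k)).
have lD : lives D (end_of rr) by apply/lives_end_of => //; exists 0%N.
have PP : P (end_of rr).
  by apply: sticks_cover => // K fK /lives_end_of h; exact/st/h.
have [R [m [n [RRR e]]]] := RRmax rD PP (end_of_mem rr).
have [Dn] := comp_sub (rC n); apply.
rewrite -e; apply: sub_dcl; first by move=> y [/SD|/rays_coverD].
by right; exists R, m.
Qed.

End RayCover.

Lemma envelope D S (P : set (ends G)) : fbd D -> S `<=` D -> dispersed_in D S ->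
  closed_in D P ->
  exists A, [/\ S `<=` A, A `<=` D, forall u, (D `\` A) u -> fbd (comp_of (D `\` A) u) &
    forall w, lives D w -> sticks A w <-> P w].
Proof.
move=> fD SD Sd Pc; have [RR [ok dj mx]] := max_rays D P.
exists (dcl D (S `|` rays_cover RR)); split.
- apply: subset_trans (sub_dcl _); first by move=> x; left.
  by move=> y [/SD//|/(rays_coverD ok)].
- by move=> v [].
- exact: (fbd_dcl_comp fD SD ok dj mx Sd Pc).
- exact: (sticks_dcl fD SD ok dj mx Sd Pc).
Qed.

End Envelope.

(** * Separating a closed discrete set of ends *)

Section Split.
Variable G : sgraph.
Implicit Types (A B K L X F S : set G) (u v : G) (r : nat -> G) (w : ends G).

Definition discrete_in D (P : set (ends G)) := forall w, lives D w -> P w ->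
  exists K, [/\ fbd K, lives K w & forall w', P w' -> lives K w' -> w' = w].

Lemma not_sticksS A B w : A `<=` B -> ~ sticks B w -> ~ sticks A w.
Proof.
move=> AB nB sA; apply: nB => K fK lK; have [x [Kx Ax]] := sA K fK lK.
by exists x; split => //; exact: AB.
Qed.

Lemma dispersed0 D : dispersed_in D (@set0 G).
Proof.
move=> w _ /(_ setT (fbdT G) (livesT w)) [x [_ []]].
Qed.

(* In the envelope B of P, every vertex in a set K that meets only rays of one
   w in P is labelled w; the labels are unique because a set with finite boundary
   around a vertex of B meets the rays. S consists of the unlabelled vertices W0 of B
   and of the labelled ones Q that have a neighbour with another label in the
   torso of B (the relation H). Around w, the set Q is finite: such neighbours
   outside K lie in the finite set Z K, and conversely. *)
Lemma separate_discrete D (P : set (ends G)) : fbd D -> closed_in D P -> discrete_in D P ->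
  exists S, [/\ S `<=` D, dispersed_in D S &
    forall K, conn K -> fbd K -> K `<=` D `\` S ->
      forall w w', P w -> P w' -> lives K w -> lives K w' -> w = w'].
Proof.
move=> fD Pcl Pdisc; have [RR [ok dj mx]] := max_rays D P.
pose A := set0 `|` rays_cover RR; pose B := dcl D A; pose O := D `\` B.
have sD0 : set0 `<=` D by [].
have stP := sticks_dcl fD sD0 ok dj mx (@dispersed0 D) Pcl.
have fO x : O x -> fbd (comp_of O x).
  exact: (fbd_dcl_comp fD sD0 ok dj mx (@dispersed0 D) Pcl).
pose isol K w := [/\ fbd K, K `<=` D, lives K w & forall R n, RR R -> K (R n) -> val w R].
have isol_ex w : lives D w -> P w -> exists K, isol K w.
  move=> lD Pw; have [K [fK lK Kw]] := Pdisc w lD Pw.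
  have fKD : fbd (K `&` D) by exact: fbdI.
  have fin := finite_escaping fKD (fun R h => let: And3 a _ _ := ok R h in a) dj.
  (* Deleting the finitely many vertices on rays without a tail in K and D leaves a set that only
     rays of w meet. *)
  exists ((K `&` D) `\` [set v | (K `&` D) v /\ exists R n, [/\ RR R, R n = v & ~ tail_in (K `&` D) R]]).
  split; first exact: fbdD.
  - by move=> v [[]].
  - by apply: livesD => //; exact: livesI.
  move=> R n RRR [Kn nn]; have [_ _ [w' Pw' w'R]] := ok _ RRR.
  have t : tail_in (K `&` D) R.
    by apply: contrapT => nt; apply: nn; split => //; exists R, n.
  by rewrite -(Kw w' Pw') //; exists R => //; apply: tail_inS t => x [].
have isol_uniq K w K' w' v : isol K w -> isol K' w' -> B v -> K v -> K' v -> w = w'.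
  move=> [fK _ _ h] [fK' _ _ h'] [_ Bv] Kv K'v.
  have [|x [[Kx K'x] [//|[R [n [RRR Rn]]]]]] := Bv (K `&` K') (fbdI fK fK'); first by [].
  by rewrite -Rn in Kx K'x; exact: ends_eq_ray (h _ _ RRR Kx) (h' _ _ RRR K'x).
pose H u v := adj u v \/ exists x, [/\ O x, nb (comp_of O x) u & nb (comp_of O x) v].
pose Z K := nb K `|` \bigcup_(z in nb K `&` O) nb (comp_of O z).
have Hsym u v : H u v -> H v u.
  by case=> [uv|[x [? ? ?]]]; [left; rewrite adj_sym|right; exists x].
have Zfin K : fbd K -> finite_set (Z K).
  move=> fK; rewrite finite_setU; split => //.
  by apply: bigcup_finite; [exact: finite_setIl|move=> z [_ /fO]].
(* A torso edge through a component of O either passes a vertex of [nb K] in that component, or the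
   component lies in K and u is in [nb K]. *)
have HZ K u v : K v -> ~ K u -> H v u -> Z K u.
  move=> Kv Ku [vu|[x [Ox [vx [y xy yv]] [ux [y' xy' y'u]]]]].
    by left; split => //; exists v.
  have [[z [xz nz]]|h] := pselect (exists z, comp_of O x z /\ nb K z).
    right; exists z; first by split => //; exact: comp_sub xz.
    by rewrite (comp_eq xz); split => //; exists y'.
  have sub y0 : comp_of O x y0 -> K y0 -> comp_of O x `<=` K.
    move=> xy0 Ky0; apply: (conn_in (@comp_conn _ O x)) xy0 Ky0.
    by move=> z [xz nz]; apply: h; exists z.
  left; split => //; exists y' => //; apply: (sub y) => //.
  apply: contrapT => Ky; apply: h; exists y; split => //; split => //.
  by exists v => //; rewrite adj_sym.
pose W0 := [set v | B v /\ forall K w, isol K w -> ~ K v].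
pose Q := [set v | B v /\ exists u K w K' w',
  [/\ isol K w, K v, isol K' w' & K' u] /\ [/\ B u, w <> w' & H v u]].
have SB : W0 `|` Q `<=` B by move=> v [] [].
exists (W0 `|` Q); split.
- by move=> v /SB[].
- move=> w lD; have [Pw|nPw] := pselect (P w); last first.
    by apply: (not_sticksS SB) => /(stP _ lD).
  have [K iK] := isol_ex w lD Pw.
  have [fK KD lK _] := iK.
  (* [k u] witnesses a label of u other than w if there is one; otherwise it is the default
     [setT]. *)
  have /choice[k kP] : forall u, exists K', fbd K' /\
     ((exists K'' w', [/\ isol K'' w', K'' u & w <> w']) ->
      exists w', [/\ isol K' w', K' u & w <> w']).
    move=> u; have [[K'' [w' [i Ku ne]]]|h] := pselect (exists K'' w', [/\ isol K'' w', K'' u & w <> w']).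
      by exists K''; split; [case: i|move=> _; exists w'].
    by exists setT; split; [exact: fbdT|move=> /h].
  (* A vertex v of Q in K has label w, so its torso neighbour u with another label is outside K and
     lies in [Z K]. By symmetry v is in [Z (k u)]. *)
  have QK : Q `&` K `<=` \bigcup_(u in Z K) Z (k u).
    move=> v [[Bv [u [K1 [w1 [K2 [w2 [[i1 K1v i2 K2u] [Bu ne Hvu]]]]]]]] Kv].
    have e := isol_uniq _ _ _ _ _ i1 iK Bv K1v Kv; rewrite e in ne.
    have Ku : ~ K u by move=> Ku; apply: ne; exact: isol_uniq iK i2 Bu Ku K2u.
    exists u; first exact: HZ Kv Ku Hvu.
    have [w' [i' ku ne']] := (kP u).2 (ex_intro _ K2 (ex_intro _ w2 (And3 i2 K2u ne))).
    apply: (HZ (k u) _ u) => //; last exact: Hsym.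
    by move=> kv; apply: ne'; exact: isol_uniq iK i' Bv Kv kv.
  have fQ : finite_set (Q `&` K).
    apply: sub_finite_set QK _; apply: bigcup_finite; first exact: Zfin.
    by move=> u _; apply: Zfin; exact: (kP u).1.
  move=> /(_ (K `\` (Q `&` K)) (fbdD fK fQ) (livesD fK fQ lK)) [x [[Kx nQ]]].
  case=> [[_ /(_ K w iK)]//|Qx]; by apply: nQ.
- move=> K0 cK0 fK0 K0D w w' Pw Pw' l l'.
  have start w1 : P w1 -> lives K0 w1 -> exists K v, [/\ isol K w1, K v, B v & K0 v].
    move=> Pw1 l1; have lD : lives D w1 by apply: livesS l1 => x /K0D[].
    have [K iK] := isol_ex _ lD Pw1; have [fK _ lK _] := iK.
    have [v [[Kv K0v] Bv]] := (stP _ lD).2 Pw1 _ (fbdI fK fK0) (livesI fK lK l1).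
    by exists K, v.
  have [K [v [iK Kv Bv K0v]]] := start w Pw l.
  have [K' [v' [iK' K'v Bv' K0v']]] := start w' Pw' l'.
  pose lab x := [/\ B x, K0 x & exists K1, isol K1 w /\ K1 x].
  have labH x y : lab x -> B y -> K0 y -> H x y -> lab y.
    move=> [Bx K0x [K1 [i1 K1x]]] By K0y Hxy; split => //.
    have [_ nS] := K0D _ K0y.
    have [K2 [w2 [i2 K2y]]] : exists K2 w2, isol K2 w2 /\ K2 y.
      apply: contrapT => h; apply: nS; left; split => // K2 w2 i2 K2y.
      by apply: h; exists K2, w2.
    have [e|ne] := pselect (w = w2); first by exists K2; rewrite e.
    have [_ nS'] := K0D _ K0x; case: nS'; right; split => //.
    by exists y, K1, w, K2, w2.
  (* The invariant along a path in K0: a vertex of B has label w, and a vertex of O lies in a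
     component of O with a neighbour of label w. *)
  pose I x := [/\ K0 x, B x -> lab x & ~ B x -> exists2 z, lab z & nb (comp_of O x) z].
  have Istep x y : I x -> K0 y -> adj x y -> I y.
    move=> [K0x h1 h2] K0y xy; have [Dx _] := K0D _ K0x; have [Dy _] := K0D _ K0y.
    split => // [By|By]; have [Bx|Bx] := pselect (B x).
    - by apply: labH (h1 Bx) By K0y _; left.
    - have [z lz xz] := h2 Bx; apply: (labH _ _ lz By K0y); have Ox : O x by [].
      right; exists x; split => //.
      by split; [move=> /comp_sub[]|exists x => //; exact: comp_refl].
    - exists x; first exact: h1.
      split; [by move=> /comp_sub[]|exists y; first exact: comp_refl].
      by rewrite adj_sym.
    - have [z lz xz] := h2 Bx; exists z => //.
      by rewrite (@comp_eq _ O x) //; apply: linked_adj.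
  have Iv : I v.
    by split => // _; split => //; exists K.
  have [s [ps ls sK]] := cK0 _ _ K0v K0v'.
  have : I v'.
    elim: s v Iv ps ls sK {Kv Bv K0v} => [|y s IH] x Ix /=; first by move=> _ <-.
    move=> /andP[xy ps] ls sK; apply: (IH y) => //.
      by apply: (Istep x) => //; apply: sK; rewrite /= !inE eqxx orbT.
    by move=> z zs; apply: sK; rewrite /= in_cons; apply/orP; right.
  move=> [_ /(_ Bv')[_ _ [K1 [i1 K1v']]] _].
  exact: isol_uniq i1 iK' Bv' K1v' K'v.
Qed.

End Split.

(** * Exhausting the graph *)

Section Levels.
Variable G : sgraph.
Implicit Types (A B D K L X F S U W : set G) (u v : G) (w : ends G) (E : nat -> set (ends G)).

Definition ended D := forall u, D u -> fbd (comp_of D u) /\ exists w, lives (comp_of D u) w.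

(* Components of D minus the envelope without ends are added to the envelope. *)
Lemma one_ended D S w0 : fbd D -> S `<=` D -> dispersed_in D S -> lives D w0 ->
  exists A, [/\ S `<=` A, A `<=` D, ended (D `\` A) &
    forall w, lives D w -> sticks A w <-> w = w0].
Proof.
move=> fD SD Sd lD; have [w _ ww0|A0 [SA AD fA stA]] := @envelope _ D S [set w0] fD SD Sd.
  by have [K [fK lK nK]] := ends_sep ww0; exists K; split => // _ ->.
pose A := A0 `|` [set u | (D `\` A0) u /\ ~ exists w, lives (comp_of (D `\` A0) u) w].
have A0A : A0 `<=` A by move=> x; left.
have ADD : A `<=` D by move=> x [/AD|[[]]].
have sub u : D u -> ~ A u -> comp_of (D `\` A0) u = comp_of (D `\` A) u.
  move=> Du Au; apply/seteqP; split; last first.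
    by apply: compS => x [Dx Ax]; split => // /A0A.
  apply: conn_sub_comp; [exact: comp_conn| |apply: comp_refl; split => // /A0A //].
  move=> x ux; have [Dx A0x] := comp_sub ux; split => // -[//|[_ nx]]; apply: (Au); right.
  by split; [split => // /A0A|rewrite -(comp_eq ux)].
exists A; split => //.
- exact: subset_trans A0A.
- move=> u [Du Au]; rewrite -sub //.
  have O0u : (D `\` A0) u by split => // /A0A.
  split; first exact: fA.
  by apply: contrapT => nw; apply: Au; right.
- move=> w lw; rewrite -[_ = _]/([set w0] w) -stA //; split => st K fK lK; last first.
    by have [x [Kx Ax]] := st K fK lK; exists x; split => //; exact: A0A.
  (* If K missed A0, a component of K in D in which w lives would lie in one component of D minus
     A0. The latter has an end, so none of its vertices was added. *)
  apply: contrapT => nKA.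
  have [u [Ku Du] lu] := lives_comp (livesI fK lK lw).
  have fKu : fbd (comp_of (K `&` D) u) by exact/fbd_comp/fbdI.
  have Ku0 : comp_of (K `&` D) u `<=` D `\` A0.
    move=> x /comp_sub[Kx Dx]; split => // A0x; apply: nKA; by exists x.
  have [x [ux Ax]] := st _ fKu lu.
  have [Dx A0x] := Ku0 _ ux.
  case: Ax => [//|[_ nx]]; apply: nx; exists w; apply: livesS lu.
  by apply: conn_sub_comp ux => //; exact: comp_conn.
Qed.

(* E j will be the set of ends in the j-th derivative of the closure of a slender
   set. With i = 2j, no end of E j lives in D; with i = 2j + 1, at most one does. *)
Definition kill D E i :=
  if odd i then forall w w', lives D w -> lives D w' -> E i./2 w -> E i./2 w' -> w = w'
  else forall w, lives D w -> ~ E i./2 w.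

Lemma killS D K E i : K `<=` D -> kill D E i -> kill K E i.
Proof.
move=> KD; rewrite /kill; case: ifP => _ h.
  by move=> w w' /(livesS KD) l /(livesS KD) l'; exact: h.
by move=> w /(livesS KD); exact: h.
Qed.

(** Each application lowers the counter i by one. From 2j + 2 to 2j + 1 the ends of [E j], now
    discrete in D, are separated; from 2j + 1 to 2j the remaining one, if any, becomes w0; at 0 the
    set U is absorbed. *)
Lemma one_ended_progress D U E i : fbd D -> (exists w, lives D w) ->
  (forall j, closed_in D (E j)) ->
  (forall j, (forall w, lives D w -> ~ E j.+1 w) -> discrete_in D (E j)) ->
  (forall w, ~ E 0%N w -> ~ sticks U w) ->
  exists A w0, [/\ A `<=` D, lives D w0, ended (D `\` A),
    forall w, lives D w -> sticks A w <-> w = w0 &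
    kill D E i -> if i is i'.+1
      then forall K, conn K -> fbd K -> K `<=` D `\` A -> kill K E i'
      else U `&` D `<=` A].
Proof.
move=> fD [w1 l1] Ecl Edisc E0.
have [ki|nki] := pselect (kill D E i); last first.
  have [A [_ AD eA sA]] := one_ended fD (fun x (h : set0 x) => False_ind _ h) (@dispersed0 _ D) l1.
  by exists A, w1; split.
case: i ki => [|i] ki.
  have [|w lw|A [SA AD eA sA]] := @one_ended D (U `&` D) w1 fD _ _ l1.
  - by move=> x [].
  - by apply: not_sticksS (E0 w (ki w lw)) => x [].
  - by exists A, w1; split.
have [oi|ei] := boolP (odd i).
  have [|S [SD Sd hS]] := separate_discrete fD (Ecl i./2) (Edisc i./2 _).
    by move: ki; rewrite /kill /= oi uphalf_half oi.
  have [A [SA AD eA sA]] := one_ended fD SD Sd l1.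
  exists A, w1; split => // _ K cK fK KDA; rewrite /kill oi => w w' lw lw' Ew Ew'.
  apply: (hS K cK fK) => // x /KDA[Dx Ax]; split => // /SA //.
move: ki; rewrite /kill /= (negbTE ei) uphalf_half (negbTE ei) add0n => ki.
have [[w0 [l0 Ew0]]|h] := pselect (exists w0, lives D w0 /\ E i./2 w0).
  have [A [_ AD eA sA]] := one_ended fD (fun x (h : set0 x) => False_ind _ h) (@dispersed0 _ D) l0.
  exists A, w0; split => // _ K cK fK KDA w lK Ew.
  have lD : lives D w by apply: livesS lK => x /KDA[].
  have [x [Kx Ax]] := (sA _ lD).2 (ki _ _ lD l0 Ew Ew0) K fK lK.
  by case: (KDA _ Kx).
have [A [_ AD eA sA]] := one_ended fD (fun x (h : set0 x) => False_ind _ h) (@dispersed0 _ D) l1.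
exists A, w1; split => // _ K cK fK KDA w lK Ew; apply: h; exists w; split => //.
by apply: livesS lK => x /KDA[].
Qed.

Definition good W := ended (~` W).
Definition killW W E i := forall u, ~ W u -> kill (comp_of (~` W) u) E i.
(* Exactly one end of each component of G - W lives in no component of G - W'. *)
Definition step W W' := W `<=` W' /\ forall u, ~ W u -> exists w0,
  lives (comp_of (~` W) u) w0 /\ forall w, lives (comp_of (~` W) u) w ->
    (w = w0 <-> forall v, ~ W' v -> ~ lives (comp_of (~` W') v) w).

Lemma killWS W W' E i : W `<=` W' -> killW W E i -> killW W' E i.
Proof.
move=> WW' h u Wu; have WWu : ~ W u by move=> /WW'.
by apply: killS (h u WWu); apply: compS => x Wx /WW'.
Qed.

Lemma step_exists W U E i : good W ->
  (forall D j, closed_in D (E j)) ->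
  (forall D j, (forall w, lives D w -> ~ E j.+1 w) -> discrete_in D (E j)) ->
  (forall w, ~ E 0%N w -> ~ sticks U w) ->
  exists W', [/\ good W', step W W' &
    killW W E i -> if i is i'.+1 then killW W' E i' else U `<=` W'].
Proof.
move=> gW Ecl Edisc E0.
(* A is chosen for each set D and not for each vertex, so that all vertices of one component share
   it. *)
have /choice[A AP] : forall D, exists A, fbd D -> (exists w, lives D w) ->
  exists w0, [/\ A `<=` D, lives D w0, ended (D `\` A),
    forall w, lives D w -> sticks A w <-> w = w0 &
    kill D E i -> if i is i'.+1
      then forall K, conn K -> fbd K -> K `<=` D `\` A -> kill K E i'
      else U `&` D `<=` A].
  move=> D; have [[fD lD]|h] := pselect (fbd D /\ exists w, lives D w); last first.
    by exists set0 => fD lD; case: h.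
  have [A [w0 AP]] := one_ended_progress i fD lD (Ecl D) (Edisc D) E0.
  by exists A => _ _; exists w0.
pose W' := W `|` [set v | ~ W v /\ A (comp_of (~` W) v) v].
have WW' : W `<=` W' by move=> x; left.
have AW' u x : ~ W u -> comp_of (~` W) u x -> W' x <-> A (comp_of (~` W) u) x.
  move=> Wu ux; have Wx := comp_sub ux; split => [[//|[_]]|Ax].
    by rewrite (comp_eq ux).
  by right; split => //; rewrite (comp_eq ux).
have compE v : ~ W' v -> comp_of (~` W') v =
    comp_of (comp_of (~` W) v `\` A (comp_of (~` W) v)) v.
  move=> W'v; have Wv : ~ W v by move=> /WW'.
  have Dv : comp_of (~` W) v v by exact: comp_refl.
  apply/seteqP; split.
    apply: conn_sub_comp; [exact: comp_conn| |exact: comp_refl].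
    move=> x vx; have Dx : comp_of (~` W) v x.
      by apply: compS vx => y nW' /WW'.
    by split => // /(AW' _ _ Wv Dx); exact: comp_sub vx.
  by apply: compS => x [Dx Ax] W'x; apply/Ax/AW'.
have W'D v : ~ W' v -> (comp_of (~` W) v `\` A (comp_of (~` W) v)) v.
  move=> W'v; have Wv : ~ W v by move=> /WW'.
  have Dv : comp_of (~` W) v v by exact: comp_refl.
  by split => // /(AW' _ _ Wv Dv).
have gW' : good W'.
  move=> v W'v; rewrite compE //; have Wv : ~ W v by move=> /WW'.
  have [fD lD] := gW v Wv; have [w0 [_ _ h _ _]] := AP _ fD lD.
  exact/h/W'D.
exists W'; split => //.
  split => // u Wu; have [fD lD] := gW u Wu.
  have [w0 [AD l0 eA sA _]] := AP _ fD lD.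
  exists w0; split => // w lw; rewrite -sA //; split.
    move=> st v W'v lv; have [fV _] := gW' v W'v.
    have [x [vx Ax]] := st _ fV lv.
    by apply: (comp_sub vx); apply/(AW' u) => //; exact: AD.
  move=> h; apply: contrapT => /not_sticks[K [fK lK KA]].
  have [x [Kx Dx] lx] := lives_comp (livesI fK lK lw).
  have sub : comp_of (K `&` comp_of (~` W) u) x `<=` ~` W'.
    move=> y /comp_sub[Ky Dy] /(AW' _ _ Wu Dy) Ay; exact: setI0_disj KA Ky Ay.
  have W'x : ~ W' x by apply: sub; exact: comp_refl.
  apply: (h x W'x); apply: livesS lx; apply: conn_sub_comp sub _; first exact: comp_conn.
  exact: comp_refl.
case: i AP => [|i] AP kW.
  move=> x Ux; have [Wx|Wx] := pselect (W x); first exact: WW'.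
  have [fD lD] := gW x Wx; have [w0 [_ _ _ _ /(_ (kW x Wx)) h]] := AP _ fD lD.
  have Dx : comp_of (~` W) x x by exact: comp_refl.
  by apply/(AW' x) => //; apply: h.
move=> v W'v; have Wv : ~ W v by move=> /WW'.
have [fD lD] := gW v Wv; have [w0 [_ _ _ _ /(_ (kW v Wv)) h]] := AP _ fD lD.
apply: h; [exact: comp_conn|exact: (gW' v W'v).1|].
by rewrite compE // => x /comp_sub.
Qed.

(** The exponents of 2 and 3 in n + 1 run through every pair at arbitrarily late stages. *)
Lemma schedule : exists s : nat -> nat * nat, forall p n0, exists2 n, (n0 <= n)%N & s n = p.
Proof.
exists (fun n => (logn 2 n.+1, logn 3 n.+1)) => -[k i] n0.
have pos : (0 < 2 ^ k * 3 ^ i * 5 ^ n0)%N by rewrite !muln_gt0 !expn_gt0.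
(* The power of 5 makes the stage late without affecting the two exponents. *)
exists (2 ^ k * 3 ^ i * 5 ^ n0).-1.
  rewrite -ltnS prednK //; apply: (@leq_trans (5 ^ n0)); first exact: ltn_expl.
  by rewrite leq_pmull // muln_gt0 !expn_gt0.
rewrite prednK //; congr pair;
  by rewrite !lognM ?muln_gt0 ?expn_gt0 // !lognX !logn_prime //= !muln0 muln1 ?addn0.
Qed.

(** A stage scheduled for (k, i) lowers the counter of [U k] below i if it has come down to i. What
    has been reached persists when W grows, so each [U k] is absorbed after finitely many such
    stages. *)
Lemma levels (U : nat -> set G) (E : nat -> nat -> set (ends G)) :
  connected_graph G -> [set: ends G] !=set0 ->
  (forall k D j, closed_in D (E k j)) ->
  (forall k D j, (forall w, lives D w -> ~ E k j.+1 w) -> discrete_in D (E k j)) ->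
  (forall k w, ~ E k 0%N w -> ~ sticks (U k) w) ->
  (forall k, exists N, E k N = set0) -> \bigcup_k U k = setT ->
  exists W : nat -> set G, [/\ W 0%N = set0, forall n, good (W n),
    forall n, step (W n) (W n.+1) & forall v, exists n, W n v].
Proof.
move=> [_ Gc] [w _] Ecl Edisc E0 EN Ucup; have [s sP] := schedule.
have [|n W [gW W0]|W WP] := @dep_choice (set G) (fun n W => good W /\ (n = 0%N -> W = set0))
  (fun n W W' => step W W' /\ (killW W (E (s n).1) (s n).2 ->
     if (s n).2 is i'.+1 then killW W' (E (s n).1) i' else U (s n).1 `<=` W')).
- exists set0; split => // u _; rewrite setC0; split; first exact/fbd_comp/fbdT.
  by exists w; apply: livesS (livesT w) => v _; exact: Gc.
- have [W' [? ? ?]] := step_exists (U := U (s n).1) (s n).2 gW (Ecl _) (Edisc _) (E0 _).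
  by exists W'.
exists W; split.
- by have [[_ ->]] := WP 0%N.
- by move=> n; have [[]] := WP n.
- by move=> n; have [_ []] := WP n.
have Wmon m n : (m <= n)%N -> W m `<=` W n.
  elim: n => [|n IH]; first by rewrite leqn0 => /eqP ->.
  rewrite leq_eqVlt => /orP[/eqP ->//|mn].
  by apply: subset_trans (IH mn) _; have [_ [[]]] := WP n.
move=> v; have [k _ Ukv] : (\bigcup_k U k) v by rewrite Ucup.
suff [n h] : exists n, U k `<=` W n by exists n; exact: h.
have desc i : (exists n, killW (W n) (E k) i) -> exists n, U k `<=` W n.
  elim: i => [|i IH] [n0 kn0].
    have [n nn0 sn] := sP (k, 0%N) n0; exists n.+1.
    by have [_ [_]] := WP n; rewrite sn; apply; apply: killWS kn0; exact: Wmon.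
  have [n nn0 sn] := sP (k, i.+1) n0; apply: IH; exists n.+1.
  by have [_ [_]] := WP n; rewrite sn; apply; apply: killWS kn0; exact: Wmon.
(* The counter starts at 2N, where the emptiness of [E k N] makes the property trivial. *)
have [N EkN] := EN k; apply: (desc N.*2); exists 0%N => u _.
by rewrite /kill odd_double doubleK EkN => w' _ [].
Qed.

End Levels.

(** * Orientations of the decomposition tree *)

Section Sides.
Variables (G : sgraph) (D : tree_decomposition G).
Local Notation T := (td_tree D).
Implicit Types (x y t a b : T) (u v : G) (w : ends G).

Let off x y a b := [&& adj a b, (a, b) != (x, y) & (a, b) != (y, x)].

Lemma side_refl x y : side x y x.
Proof. by exists [::]. Qed.

Lemma side_step x y a b : side x y a -> adj a b -> side x y b \/ (a = x /\ b = y).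
Proof.
move=> [s ps ls] ab.
have [[-> ->]|h1] := (a, b) =P (x, y); first by right.
have [[_ ->]|h2] := (a, b) =P (y, x); first by left; exact: side_refl.
left; exists (rcons s b); last by rewrite last_rcons.
by rewrite rcons_path ps ls /= ab /=; apply/andP; split; exact/eqP.
Qed.

Lemma side_or x y t : side x y t \/ side y x t.
Proof.
have [s [<- ps]] : exists s, last x s = t /\ path (@adj T) x s.
  by have [_ /(_ x t)[s [ps ls _]]] := (td_treeP D).1; exists s.
elim/last_ind: s ps => [|s a IH]; first by left; exact: side_refl.
rewrite rcons_path last_rcons => /andP[/IH h sa].
case: h => [/side_step/(_ sa)[|[_ ->]]|/side_step/(_ sa)[|[_ ->]]].
- by left.
- by right; exact: side_refl.
- by right.
- by left; exact: side_refl.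
Qed.

Lemma offC x y a b : off x y a b = off y x a b.
Proof. by rewrite /off andbA [RHS]andbA -!andbA [X in _ && X]andbC. Qed.

Lemma off_sym x y a b : off x y a b = off x y b a.
Proof.
rewrite /off adj_sym; congr (_ && _).
by rewrite andbC -!pair_eqE /= /pair_eq /= [(b == y) && _]andbC [(b == x) && _]andbC.
Qed.

Lemma side_back x y s a : path (off x y) a s -> side x y (last a s) -> side x y a.
Proof.
elim: s a => [//|b s IH] a /= /andP[ab /IH h] /h [s' ps' ls'].
exists (rcons s' a); last by rewrite last_rcons.
by rewrite rcons_path ls' -[X in _ && X]/(off x y b a) off_sym ab andbT.
Qed.

(** A common node would give a walk from x to y avoiding the edge xy; shortened to a path and closed
    by this edge, it is a cycle of T. *)
Lemma side_disj x y t : adj x y -> side x y t -> side y x t -> False.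
Proof.
move=> xy sx [s ps ls].
have [p pp lp] : side x y y.
  by apply: (@side_back x y s); [rewrite (eq_path (@offC x y))|rewrite ls].
case: (shortenP pp) lp => {}p {}pp up _ lp.
have : (size (x :: p) <= 2)%N.
  apply: (td_treeP D).2; rewrite /ucycle up andbT /= rcons_path lp adj_sym xy andbT.
  by apply: sub_path pp => a b /and3P[].
case: p pp up lp => [|a [|//]] /=; first by move=> _ _ e; rewrite e adj_irr in xy.
by move=> /andP[/and3P[_ + _] _] _ e; rewrite e eqxx.
Qed.

Lemma side_cross x y a s : adj x y -> path (@adj T) a s -> side x y a -> side y x (last a s) ->
  x \in a :: s /\ y \in a :: s.
Proof.
move=> xy; elim: s a => [|b s IH] a /=; first by move=> _ h /(side_disj xy h).
move=> /andP[ab ps] sa sl.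
have [sb|[-> ->]] := side_step sa ab; last by rewrite !inE !eqxx orbT.
by have [h1 h2] := IH b ps sb sl; split; rewrite in_cons ?h1 ?h2 orbT.
Qed.

Lemma side_part_or x y v : side_part x y v \/ side_part y x v.
Proof.
have [t tv] := td_vertex D v.
by have [st|st] := side_or x y t; [left|right]; exists t.
Qed.

Lemma adhesionC x y : adhesion x y = adhesion y x.
Proof. exact: setIC. Qed.

Lemma tree_path a b : exists s, [/\ path (@adj T) a s, uniq (a :: s) & last a s = b].
Proof.
have [_ /(_ a b)[s [ps ls _]]] := (td_treeP D).1.
by case: (shortenP ps) ls => s' ps' us' _ ls'; exists s'.
Qed.

(** The path of T between nodes on different sides passes through x and y, whose parts then contain
    v. *)
Lemma side_part_disj x y v : adj x y -> side_part x y v -> side_part y x v -> adhesion x y v.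
Proof.
move=> xy [a sa av] [b sb bv]; have [s [ps us ls]] := tree_path a b.
have [xs ys] : x \in a :: s /\ y \in a :: s by apply: side_cross => //; rewrite ls.
by split; apply: (td_path ps us ls) => //.
Qed.

Lemma nb_side x y : adj x y -> nb (side_part x y `\` adhesion x y) `<=` adhesion x y.
Proof.
move=> xy v [nv [u [su nu] uv]]; apply: contrapT => av; apply: nv; split => //.
have [t [tu tv]] := td_edge D uv.
have [st|st] := side_or x y t; first by exists t.
by case: nu; apply: side_part_disj => //; exists t.
Qed.

Hypothesis fD : finite_adhesion D.

Lemma fbd_side x y : adj x y -> fbd (side_part x y `\` adhesion x y).
Proof. by move=> xy; apply: sub_finite_set (nb_side xy) _; exact: fD. Qed.

(** The side minus the adhesion set has its boundary in the adhesion set, so a component of G minus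
    the adhesion set that meets this difference is one of its components. *)
Lemma orientedP w x y : adj x y ->
  oriented_to w x y <-> lives (side_part x y `\` adhesion x y) w.
Proof.
move=> xy; have fX := fD xy; have [[u uX eC] tC] := end_compP w fX.
have lC : lives (end_comp (adhesion x y) w) w.
  by have [r wr] := end_nonempty w; exists r => //; exact: tC.
split.
  by move=> [a sa e]; apply: livesS lC; rewrite e; exact: comp_sub.
move=> l; have [v [[sv nv] Cv]] := lives_ext (fbd_side xy) l lC.
exists v => //; rewrite eC in Cv *; apply/seteqP; split; last first.
  move=> a va; apply: linked_trans Cv _; apply: linkedS va.
  by move=> z [].
rewrite -/(comp_of (~` adhesion x y) u) in Cv *.
apply: (conn_sub_comp (@comp_conn _ _ _) _ Cv).
apply: (conn_in (@comp_conn _ _ _) _ Cv (conj sv nv)) => z [/comp_sub nz].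
by move=> /(nb_side xy).
Qed.

Lemma oriented_or w x y : adj x y -> oriented_to w x y \/ oriented_to w y x.
Proof.
move=> xy; have yx : adj y x by rewrite adj_sym.
have [l|nl] := pselect (lives (side_part x y `\` adhesion x y) w); first by left; apply/orientedP.
right; apply/orientedP => //; have l := not_lives (fbd_side xy) nl.
apply: livesS (livesI (fbdC (fD xy)) (livesC w (fD xy)) l) => v [av /not_orP[nv _]].
split; last by rewrite adhesionC.
have [sv|//] := side_part_or x y v; by case: nv.
Qed.

Lemma oriented_disj w x y : adj x y -> oriented_to w x y -> ~ oriented_to w y x.
Proof.
move=> xy; have yx : adj y x by rewrite adj_sym.
move=> /(orientedP _ xy) l /(orientedP _ yx) l'.
have [v [[sv nv] [sv' _]]] := lives_ext (fbd_side xy) l l'.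
by apply: nv; exact: side_part_disj.
Qed.

End Sides.

(** * Targets of orientations and levels of the rooted tree *)

Section Depth.
Variables (G : sgraph) (D : tree_decomposition G).
Local Notation T := (td_tree D).
Implicit Types (x y t a b c : T) (u v : G) (w : ends G).

Lemma side_avoid x y t : adj x y -> linked (~` [set y]) t x -> side x y t.
Proof.
move=> xy [s [ps ls sy]]; have [//|st] := side_or x y t.
have yx : adj y x by rewrite adj_sym.
have [|yin _] := side_cross yx ps st; first by rewrite ls; exact: side_refl.
by case: (sy _ yin).
Qed.

Lemma side_nested a b c : adj a b -> adj b c -> a <> c -> side c b `<=` side b a.
Proof.
move=> ab bc ac t [s ps <-]; have ba : adj b a by rewrite adj_sym.
have bac : side b a c.
  by have [//|[_ e]] := side_step (side_refl b a) bc; case: ac.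
elim/last_ind: s ps => [//|s e IH]; rewrite rcons_path last_rcons => /andP[ps /and3P[se n1 n2]].
have [//|[lb ea]] := side_step (IH ps) se.
have : side c b (last c s) by exists s.
by rewrite lb => /side_disj h; case: (h _ (side_refl b c)); rewrite adj_sym.
Qed.

Lemma side_part_nested a b c : adj a b -> adj b c -> a <> c ->
  side_part c b `<=` side_part b a.
Proof. by move=> ab bc ac v [t ct tv]; exists t => //; exact: side_nested ct. Qed.

(** The boundary of this side in T is contained in {r n}, so [livesP], applied in T, carries the
    tail from r to every ray of the end. *)
Lemma ray_side (eta : ends T) r r' n : val eta r -> val eta r' ->
  tail_in (side (r n.+1) (r n)) r'.
Proof.
move=> er; have rr := end_ray er; have xy : adj (r n.+1) (r n) by rewrite adj_sym; exact: rr.2.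
apply: livesP.
  apply: (@sub_finite_set _ _ [set r n]) => // z [nz [a sa az]].
  by have [//|[_ ->]] := side_step sa az.
exists r => //; exists n.+1 => m nm; apply: side_avoid => //; apply: linked_sym.
apply: ray_linked => // k nk /rr.1 e; by rewrite e ltnn in nk.
Qed.

Section Orientation.
Hypothesis fD : finite_adhesion D.

(** The side of c away from b lies within the side of b away from a, so an end beyond c cannot
    orient ab towards a. *)
Lemma oriented_nested w a b c : adj a b -> adj b c -> a <> c ->
  oriented_to w a b -> ~ oriented_to w c b.
Proof.
move=> ab bc ac; have cb : adj c b by rewrite adj_sym.
move=> /(orientedP fD _ ab) l /(orientedP fD _ cb) l'.
have [v [[av nv] [cv _]]] := lives_ext (fbd_side fD ab) l l'.
by apply: nv; apply: side_part_disj => //; exact: side_part_nested cv.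
Qed.

(** Induction along paths from t: by [oriented_nested], an edge pointing back to t forces the next
    edge to point back too. *)
Lemma sink w t : (forall b, adj t b -> oriented_to w t b) ->
  points_to (D := D) w (inl t).
Proof.
move=> nbh x y xy st.
have fwd s z : path (@adj T) t (rcons s z) -> uniq (t :: rcons s z) ->
    oriented_to w (last t s) z.
  elim/last_ind: s z => [|s a IH] z; first by rewrite /= andbT => tz _; exact: nbh.
  rewrite rcons_path last_rcons => /andP[psa az] us.
  have nsz : last t s <> z.
    move=> e; move: us; rewrite -rcons_cons rcons_uniq -e => /andP[/negP + _]; apply.
    by rewrite -rcons_cons mem_rcons in_cons mem_last orbT.
  have IHa : oriented_to w (last t s) a.
    by apply: IH => //; move: us; rewrite -rcons_cons rcons_uniq => /andP[_].
  have sa : adj (last t s) a by move: psa; rewrite rcons_path => /andP[].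
  have [//|o] := oriented_or fD w az.
  by case: (oriented_nested sa az nsz IHa o).
have [s [ps us ls]] := tree_path t x; rewrite -ls.
apply: fwd; first by rewrite rcons_path ps ls.
(* If y were on the path from t to x, the segment up to y would already contain x, which would then
   occur twice. *)
rewrite -rcons_cons rcons_uniq us andbT; apply/negP => yin.
move: ps us ls; case/splitPl: yin => s1 s2 l1; rewrite cat_path last_cat l1 => /andP[p1 p2] us ls.
have [|xin _] := side_cross xy p1 st; first by rewrite l1; exact: side_refl.
case: s2 p2 us ls => [|b s2] p2 us /= ls; first by rewrite ls adj_irr in xy.
move: us; rewrite -cat_cons cat_uniq => /and3P[_ /hasPn/(_ x)/=]; rewrite xin => h _.
by have := h; rewrite -ls mem_last => /(_ isT).
Qed.

(** Two different targets are separated by an edge of T, which w would orient both ways. *)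
Lemma points_to_node w t z : points_to (D := D) w (inl t) -> points_to w z -> z = inl t.
Proof.
move=> pt; case: z => [t'|eta] pz.
  have [s [ps us ls]] := tree_path t t'.
  case: s ps us ls => [|b s] /= ; first by move=> _ _ ->.
  move=> /andP[tb ps] /andP[tns us] ls.
  have bt : adj b t by rewrite adj_sym.
  have sb : side b t t'.
    have [//|h] := side_or b t t'.
    have [|_ tin] := side_cross bt ps (side_refl b t); first by rewrite ls.
    by rewrite tin in tns.
  have := pt _ _ tb (side_refl t b); have := pz _ _ bt sb.
  by move=> o1 o2; case: (oriented_disj fD tb o2 o1).
have [r er] := end_nonempty eta; have rr := end_ray er.
have [_ /(_ t (r 0%N))[s [ps ls _]]] := (td_treeP D).1.
(* From n on, the ray avoids a path from t to its first node, so t is on the near side of the edge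
   from r n to r (n + 1). *)
have [n hn] := ray_avoids rr (finite_seq (t :: s)).
have xy : adj (r n) (r n.+1) := rr.2 n.
have yx : adj (r n.+1) (r n) by rewrite adj_sym.
have sx : side (r n) (r n.+1) t.
  apply: side_avoid => //; apply: (@linked_trans _ _ _ (r 0%N)).
    by exists s; split => // z zs /= e; apply: (hn n.+1 (leqnSn n)); rewrite -e.
  have : (n < n.+1)%N by [].
  elim: (X in (X < _)%N -> linked _ _ (r X)) => [|k IH] kn.
    by apply: linked_refl => /rr.1.
  apply: linked_trans (IH (ltnW kn)) _.
  apply: linked_adj; last exact: rr.2.
    by move=> /rr.1 e; rewrite e ltnNge leqnSn in kn.
  by move=> /rr.1 e; rewrite e ltnn in kn.
have sy r' (er' : val eta r') := ray_side n er er'.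
have o1 := pt _ _ xy sx; have o2 := pz _ _ yx sy.
by case: (oriented_disj fD xy o1 o2).
Qed.

Lemma end_map_node w t : points_to (D := D) w (inl t) -> end_map D w = inl t.
Proof.
move=> pt; apply: (points_to_node pt); apply: (@xgetPex _ _ (points_to w)).
by exists (inl t).
Qed.

End Orientation.

(** [lev] is the distance from t0. The last clause holds because a path from t0 to a node beyond b
    passes through b. *)
Lemma level_exists t0 : exists lev : T -> nat, [/\ forall t, lev t = 0%N <-> t = t0,
  forall a b, adj a b -> (lev b <= (lev a).+1)%N,
  forall b m, lev b = m.+1 -> exists2 a, adj a b & lev b = (lev a).+1 &
  forall a b, adj a b -> lev b = (lev a).+1 ->
    forall s, side b a s -> s <> b -> (lev b < lev s)%N].
Proof.
pose Pl t n := exists s, [/\ path (@adj T) t0 s, last t0 s = t & size s = n].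
have /choice[lev levP] : forall t, exists n, Pl t n /\ forall m, Pl t m -> (n <= m)%N.
  move=> t; have [_ /(_ t0 t)[s [ps ls _]]] := (td_treeP D).1.
  have [|n h1 h2] := @ex_minimal (Pl t); last by exists n.
  by exists (size s), s.
have lev_le s a : path (@adj T) t0 s -> a \in t0 :: s -> (lev a <= size s)%N /\
    (a <> last t0 s -> (lev a < size s)%N).
  move=> ps ain; move: ps; case/splitPl: ain => s1 s2 l1; rewrite cat_path l1 => /andP[p1 p2].
  have la : (lev a <= size s1)%N by apply: (levP a).2; exists s1.
  rewrite size_cat last_cat l1; split; first exact: leq_trans la (leq_addr _ _).
  case: s2 {p2} => [//|b s2] _ /=; rewrite addnS ltnS.
  exact: leq_trans la (leq_addr _ _).
have lev1 a b : adj a b -> (lev b <= (lev a).+1)%N.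
  move=> ab; have [[s [ps ls <-]] _] := levP a.
  apply: (levP b).2; exists (rcons s b); rewrite size_rcons last_rcons; split => //.
  by rewrite rcons_path ps ls.
exists lev; split => //.
- move=> t; split.
    by move=> e; have [[s [_ ls ss]] _] := levP t; rewrite e in ss; rewrite -ls (size0nil ss).
  by move=> ->; apply/eqP; rewrite -leqn0; apply: (levP t0).2; exists [::].
- move=> b m lb; have [[s [ps ls ss]] _] := levP b.
  case/lastP: s ps ls ss => [|s c]; first by rewrite lb.
  rewrite rcons_path last_rcons size_rcons => /andP[ps +] e; rewrite e => sb ss.
  exists (last t0 s) => //; apply/eqP; rewrite eqn_leq lev1 //= -ss ltnS.
  by apply: (levP _).2; exists s.
move=> a b ab lb s sb nsb; have ba : adj b a by rewrite adj_sym.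
have s0 : side a b t0.
  have [//|h] := side_or a b t0; have [[p [pp lp sp]] _] := levP a.
  have [|bin _] := side_cross ba pp h; first by rewrite lp; exact: side_refl.
  by have [] := lev_le _ _ pp bin; rewrite sp lb ltnn.
have [[q [pq lq sq]] _] := levP s.
have [|_ bin] := side_cross ab pq s0; first by rewrite lq.
have [_] := lev_le _ _ pq bin; rewrite lq sq; apply; exact/nesym.
Qed.

(** Follow the orientation from t0. Unless a target of level at most n is reached, some edge points
    to a node of level n + 1; no node beyond it has level at most n, so w would not be in the
    closure. *)
Lemma part_end_level (lev : T -> nat) t0 w n : finite_adhesion D ->
  (forall t, lev t = 0%N <-> t = t0) ->
  (forall a b, adj a b -> (lev b <= (lev a).+1)%N) ->
  (forall a b, adj a b -> lev b = (lev a).+1 ->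
    forall s, side b a s -> s <> b -> (lev b < lev s)%N) ->
  sticks (\bigcup_(t in [set t | (lev t <= n)%N]) td_part t) w ->
  exists2 t, (lev t <= n)%N & points_to (D := D) w (inl t).
Proof.
move=> fD lev0 lev1 levs st.
have claim m : (exists2 t, (lev t < m)%N & points_to (D := D) w (inl t)) \/
    exists t, lev t = m /\ (m = 0%N \/
      exists p, [/\ adj p t, lev t = (lev p).+1 & oriented_to w t p]).
  elim: m => [|m [[t lt pt]|[t [ltm h]]]].
  - by right; exists t0; split; [exact/lev0|left].
  - by left; exists t => //; exact: leqW.
  have [pt|npt] := pselect (points_to (D := D) w (inl t)).
    by left; exists t => //; rewrite ltm.
  have [b tb nb] : exists2 b, adj t b & ~ oriented_to w t b.
    apply: contrapT => hh; apply: npt; apply: sink => // b tb.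
    by apply: contrapT => nb; apply: hh; exists b.
  have ob : oriented_to w b t by have [] := oriented_or fD w tb.
  have lb : lev b = (lev t).+1.
    apply/eqP; rewrite eqn_leq lev1 //=.
    case: h => [m0|[p [pt lp op]]].
      rewrite ltm m0 lt0n; apply/eqP => /lev0 e.
      have : t = t0 by apply/lev0; rewrite ltm.
      by move=> e'; rewrite e e' adj_irr in tb.
    apply: (levs p t pt lp).
      have [//|[_ e]] := side_step (side_refl t p) tb.
      by rewrite e in ob; case: (oriented_disj fD pt ob op).
    by move=> e; rewrite e adj_irr in tb.
  by right; exists b; split; [rewrite lb ltm|right; exists t].
have [[t lt pt]|[t [lt [//|[p [pt lp op]]]]]] := claim n.+1; first by exists t.
exfalso; have tp : adj t p by rewrite adj_sym.
have /(orientedP fD _ tp) l := op.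
have [v [[sv nv] [s /= ls vs]]] := st _ (fbd_side fD tp) l.
apply: nv; apply: side_part_disj => //; exists s => //.
have [//|h] := side_or p t s.
have [e|ne] := pselect (s = t); first by rewrite e lt ltnn in ls.
have := levs p t pt lp s h ne; rewrite lt => /ltnW hh.
by have := leq_trans hh ls; rewrite ltnn.
Qed.

End Depth.

(** * The tree-decomposition of an exhaustion *)

Section LevelTree.
Variables (G : sgraph) (W : nat -> set G).
Implicit Types (u v : G) (w : ends G).

(** The level is stored as well, since the same set may be a component of G - [W n] for several
    n. *)
Definition level_nodes : set (nat * set G) :=
  [set p | exists2 u, ~ W p.1 u & p.2 = comp_of (~` W p.1) u].
Definition node : choiceType := level_nodes.
Implicit Types (s t a b : node).

Definition lv t := (val t).1.
Definition cs t := (val t).2.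
Definition child t s := lv t = (lv s).+1 /\ cs t `<=` cs s.

Lemma csE t v : cs t v -> cs t = comp_of (~` W (lv t)) v.
Proof.
have [u _ e] := set_mem (valP t).
by rewrite /cs /lv e => uv; rewrite (comp_eq uv).
Qed.

Lemma cs_nonempty t : cs t !=set0.
Proof.
have [u uW e] := set_mem (valP t).
by exists u; rewrite /cs e; exact: comp_refl.
Qed.

Lemma cs_out t : cs t `<=` ~` W (lv t).
Proof. by move=> v tv; have := tv; rewrite (csE tv) => /comp_sub. Qed.

Lemma cs_conn t : conn (cs t).
Proof. by have [u tu] := cs_nonempty t; rewrite (csE tu); exact: comp_conn. Qed.

Lemma nb_cs t : nb (cs t) `<=` W (lv t).
Proof. by have [u tu] := cs_nonempty t; rewrite (csE tu) => v /nb_comp[/contrapT]. Qed.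

Lemma node_eq s t v : lv s = lv t -> cs s v -> cs t v -> s = t.
Proof.
move=> e sv tv; apply/val_inj; have : cs s = cs t by rewrite (csE sv) (csE tv) e.
by move: e; rewrite /lv /cs; case: (val s) (val t) => [? ?] [? ?] /= -> ->.
Qed.

Lemma node_of n v : ~ W n v -> exists2 t, lv t = n & cs t v.
Proof.
move=> nv; have h : (n, comp_of (~` W n) v) \in level_nodes by apply/mem_set; exists v.
by exists (exist (fun p => p \in level_nodes) _ h) => //; exact: comp_refl.
Qed.

Definition node_adj s t := `[< child t s \/ child s t >].

Lemma node_adjP s t : reflect (child t s \/ child s t) (node_adj s t).
Proof. exact: asboolP. Qed.

Lemma node_adj_sym : symmetric node_adj.
Proof. by move=> s t; apply/node_adjP/node_adjP => -[]; [right|left|right|left]. Qed.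

Lemma node_adj_irr : irreflexive node_adj.
Proof. by move=> t; apply/negbTE/node_adjP => -[] [/n_Sn]. Qed.

Definition level_tree := SGraph node_adj_sym node_adj_irr.

Hypothesis Wmon : forall m n, (m <= n)%N -> W m `<=` W n.
Hypothesis W0 : W 0%N = set0.
Hypothesis Gc : connected_graph G.

Lemma cs_nested s t v : (lv s <= lv t)%N -> cs s v -> cs t v -> cs t `<=` cs s.
Proof.
move=> st sv tv; rewrite (csE sv); apply: conn_sub_comp tv; first exact: cs_conn.
by move=> x /cs_out h /(Wmon st).
Qed.

Lemma childP s t v : lv t = (lv s).+1 -> cs s v -> cs t v -> child t s.
Proof. by move=> e sv tv; split => //; apply: cs_nested sv tv; rewrite e. Qed.

Lemma child_uniq t s s' : child t s -> child t s' -> s = s'.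
Proof.
move=> [e h] [e' h']; have [v tv] := cs_nonempty t.
by apply: (@node_eq _ _ v); [apply: succn_inj; rewrite -e -e'|exact: h|exact: h'].
Qed.

Lemma parent_exists t m : lv t = m.+1 -> exists s, child t s.
Proof.
move=> tm; have [v tv] := cs_nonempty t.
have nv : ~ W m v by move=> /(Wmon (leqnSn m)); rewrite -tm; exact: cs_out tv.
have [s sm sv] := node_of nv.
by exists s; apply: childP sv tv; rewrite sm.
Qed.

Lemma adjP s t : adj (s : level_tree) t <-> child t s \/ child s t.
Proof. by split => /node_adjP. Qed.

Lemma lv0E s t : lv s = 0%N -> lv t = 0%N -> s = t.
Proof.
move=> s0 t0; have [u su] := cs_nonempty s; have [v tv] := cs_nonempty t.
apply: (@node_eq _ _ u) => //; first by rewrite s0.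
rewrite (csE tv) t0 W0 setC0; exact: Gc.2.
Qed.

Lemma level_tree_connected : connected_graph level_tree.
Proof.
have [[v0 _] _] := Gc.
have [t0 t00 _] : exists2 t, lv t = 0%N & cs t v0 by apply: node_of; rewrite W0.
split; first by exists t0.
have H (t : level_tree) : linked setT t t0.
  elim: {t}(lv t) {-2}t (erefl (lv t)) => [|m IH] t tm.
    by rewrite (lv0E tm t00); exact: linked_refl.
  have [s ts] := parent_exists tm.
  apply: (@linked_trans _ _ _ (s : level_tree)).
    by apply: linked_adj => //; apply/adjP; right.
  by apply: IH; case: ts => + _; rewrite tm => -[].
by move=> s t; apply: linked_trans (H s) (linked_sym (H t)).
Qed.

(** A node of maximal level on a cycle would have two distinct parents. *)
Lemma level_tree_acyclic : acyclic level_tree.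
Proof.
move=> c /andP[cc uc]; rewrite leqNgt; apply/negP => c3.
have [x xc xmax] : exists2 x, x \in c & forall y, y \in c -> (lv y <= lv x)%N.
  case: c c3 {cc uc} => [//|a c _]; elim: c a => [|b c IH] a.
    by exists a; rewrite ?inE // => y; rewrite inE => /eqP ->.
  have [x xc xm] := IH b; have [le|lt] := leqP (lv a) (lv x).
    exists x; first by rewrite in_cons xc orbT.
    by move=> y; rewrite in_cons => /orP[/eqP ->//|/xm].
  exists a; first exact: mem_head.
  move=> y; rewrite in_cons => /orP[/eqP ->//|/xm h]; exact: ltnW (leq_ltn_trans h lt).
have [i s' e] := rot_to xc.
have cx : cycle (@adj level_tree) (x :: s') by rewrite -e rot_cycle.
have ux : uniq (x :: s') by rewrite -e rot_uniq.
have sx : size (x :: s') = size c by rewrite -e size_rot.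
have mx y : y \in x :: s' -> (lv y <= lv x)%N by rewrite -e mem_rot; exact: xmax.
case: s' cx ux sx mx {e} => [|y s]; first by move=> _ _ sx; rewrite -sx in c3.
case/lastP: s => [|s z]; first by move=> _ _ sx; rewrite -sx in c3.
move=> cx ux _ mx; have par b : b \in [:: x, y & rcons s z] -> adj (x : level_tree) b -> child x b.
  move=> /mx bx /adjP[[bl _]|//]; by rewrite bl ltnn in bx.
have xy : child x y.
  by apply: par; [rewrite !inE eqxx orbT|case/andP: cx].
have xz : child x z.
  apply: par; first by rewrite !in_cons mem_rcons mem_head !orbT.
  move: cx; rewrite /= rcons_path last_rcons => /andP[_ /andP[_]].
  by rewrite node_adj_sym.
move: ux; rewrite (child_uniq xy xz) /= mem_rcons mem_head.
by rewrite andbF.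
Qed.

Lemma level_treeP : is_tree level_tree.
Proof. by split; [exact: level_tree_connected|exact: level_tree_acyclic]. Qed.

Definition part (t : level_tree) : set G := nb (cs t) `|` (cs t `&` W (lv t).+1).

Lemma part_sub t : part t `<=` W (lv t).+1.
Proof. by move=> v [/nb_cs|[]] //; exact: Wmon. Qed.

Hypothesis Wcup : forall v, exists n, W n v.

Lemma first_level v : exists2 n, ~ W n v & W n.+1 v.
Proof.
have [[|n] Wn nmin] := ex_minimal (Wcup v); first by rewrite W0 in Wn.
by exists n => // /nmin; rewrite ltnn.
Qed.

Lemma part_vertex v : exists t, part t v.
Proof.
have [n nv Wv] := first_level v; have [t tn tv] := node_of nv.
by exists t; right; rewrite tn.
Qed.

(** The part of the endvertex that enters W later serves: the other one is in the same component or
    a neighbour of it. *)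
Lemma part_edge u v : adj u v -> exists t, part t u /\ part t v.
Proof.
have [m mu Wu] := first_level u; have [n nv Wv] := first_level v.
wlog mn : u v m n mu Wu nv Wv / (m <= n)%N => [H|] uv.
  have [mn|/ltnW nm] := leqP m n; first exact: (H u v m n).
  rewrite adj_sym in uv; have [t [? ?]] := H v u n m nv Wv mu Wu nm uv.
  by exists t.
have [t tn tv] := node_of nv; exists t; split; last by right; rewrite tn.
have [nu|nu] := pselect (cs t u).
  by right; split => //; rewrite tn; apply: Wmon Wu; rewrite ltnS.
by left; split => //; exists v => //; rewrite adj_sym.
Qed.

(** * Descendants and the path axiom *)

Definition desc b t := (lv b <= lv t)%N /\ cs t `<=` cs b.

Lemma desc_refl b : desc b b.
Proof. by split. Qed.

Lemma desc_step b (t t' : level_tree) : desc b t -> adj t t' -> desc b t' \/ (t = b /\ child b t').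
Proof.
move=> [bt tb] /adjP[[e h]|c].
  by left; split; [rewrite e; exact: leqW|exact: subset_trans tb].
have [e h] := c; have [v tv] := cs_nonempty t.
have [le|lt] := leqP (lv b) (lv t').
  by left; split => //; apply: cs_nested le (tb _ tv) (h _ tv).
have tb' : t = b.
  by apply: (@node_eq _ _ v) => //; [apply/eqP; rewrite eqn_leq bt e lt|exact: tb].
by right; split => //; rewrite -tb'.
Qed.

Lemma desc_exit b (t : level_tree) (p : seq level_tree) : path (@adj level_tree) t p ->
  desc b t -> ~ desc b (last t p) -> (b : level_tree) \in t :: p.
Proof.
elim: p t => [//|z p IH] t /= /andP[tz pp] dt dl.
have [dz|[-> _]] := desc_step dt tz; last exact: mem_head.
by rewrite in_cons (IH z) ?orbT.
Qed.

Lemma desc_enter b (t : level_tree) (p : seq level_tree) : path (@adj level_tree) t p ->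
  ~ desc b t -> desc b (last t p) -> (b : level_tree) \in p.
Proof.
elim: p t => [//|z p IH] t /= /andP[tz pp] dt dl.
have [dz|dz] := pselect (desc b z); last by rewrite in_cons (IH z) ?orbT.
rewrite -[node_adj t z]/(adj t z) adj_sym in tz.
by have [//|[-> _]] := desc_step dz tz; rewrite mem_head.
Qed.

Lemma desc_stay b (t : level_tree) (p : seq level_tree) : path (@adj level_tree) t p ->
  desc b t -> (forall z, z \in p -> ~ child b z) -> desc b (last t p).
Proof.
elim: p t => [//|z p IH] t /= /andP[tz pp] dt nc.
apply: IH => //; last by move=> a ap; apply: nc; rewrite in_cons ap orbT.
by have [//|[_ /nc h]] := desc_step dt tz; case: h; exact: mem_head.
Qed.

Lemma desc_back b (t : level_tree) (p : seq level_tree) : path (@adj level_tree) t p ->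
  desc b (last t p) -> (forall z, z \in t :: p -> ~ child b z) -> desc b t.
Proof.
elim: p t => [//|z p IH] t /= /andP[tz pp] dl nc.
have dz : desc b z by apply: IH => // a ap; apply: nc; rewrite in_cons ap orbT.
rewrite -[node_adj t z]/(adj t z) adj_sym in tz.
by have [//|[_ /nc h]] := desc_step dz tz; case: h; exact: mem_head.
Qed.

Lemma part_desc b (t : level_tree) : desc b t -> part t `<=` cs b `|` nb (cs b).
Proof.
move=> [bt tb] v [[nv [u tu uv]]|[/tb]]; last by left.
have [bv|bv] := pselect (cs b v); [by left|right].
by split => //; exists u => //; exact: tb.
Qed.

(** If t has smaller level than b, its part lies in [W (lv b)], which misses [cs b]. Otherwise a
    common vertex makes [cs t] meet [cs b], so t is a descendant. *)
Lemma part_ndesc b (t : level_tree) v : ~ desc b t -> part t v -> ~ cs b v.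
Proof.
move=> nd tv bv; have le : (lv b <= lv t)%N.
  by rewrite leqNgt; apply/negP => lt; apply: (cs_out bv); apply: (Wmon lt); exact: part_sub.
have hit x : cs t x -> cs b x -> False.
  by move=> tx bx; apply: nd; split => //; exact: cs_nested le bx tx.
case: tv => [[_ [u tu uv]]|[tv _]]; last exact: hit tv bv.
apply: (hit u tu); rewrite (csE bv); apply: linked_adj; first exact: cs_out bv.
  by move=> /(Wmon le); exact: cs_out tu.
by rewrite adj_sym.
Qed.

Lemma nb_child b (s : level_tree) : child b s -> nb (cs b) `<=` part s.
Proof.
move=> [e h] v nv; have Wv := nb_cs nv; rewrite e in Wv.
have [sv|sv] := pselect (cs s v); [by right|left].
by split => //; case: nv => _ [u /h su uv]; exists u.
Qed.

Lemma ndesc_child b s : child b s -> ~ desc b s.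
Proof. by move=> [e _] [+ _]; rewrite e ltnn. Qed.

Lemma part_path (t1 t2 t3 : level_tree) (p : seq level_tree) :
  path (@adj level_tree) t1 p -> uniq (t1 :: p) -> last t1 p = t3 ->
  t2 \in t1 :: p -> part t1 `&` part t3 `<=` part t2.
Proof.
move=> pp up lp t2p v [v1 v3].
(* If exactly one of t1 and t3 descends from a child b of t2, then v is in the boundary of [cs b],
   which the part of t2 contains. *)
have key (b : level_tree) : child b t2 -> (desc b t1 /\ ~ desc b t3) \/ (~ desc b t1 /\ desc b t3) ->
    part t2 v.
  move=> c h; apply: (nb_child c).
  have [[d1 d3]|[d1 d3]] := h.
    by have [bv|//] := part_desc d1 v1; case: (part_ndesc d3 v3).
  by have [bv|//] := part_desc d3 v3; case: (part_ndesc d1 v1).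
move: pp up lp; case/splitPl: t2p => p1 p2 l1.
case/lastP: p1 l1 => [/= e|p1 a]; first by rewrite -e.
rewrite last_rcons => ea; rewrite {a}ea.
case: p2 => [|b p2]; first by rewrite cats0 last_rcons => _ _ ->.
rewrite cat_path last_cat last_rcons rcons_path => /andP[/andP[pp1 at2]] pbp up lp.
have /andP[t2b pp2] := pbp.
have up2 : uniq ((t1 :: p1) ++ t2 :: b :: p2) by move: up; rewrite cat_rcons.
move: up2; rewrite cat_uniq => /and3P[u1 /hasPn dis /and3P[]].
rewrite in_cons negb_or => /andP[t2nb t2p2] bp2 u2.
have ndisj x : x \in t1 :: p1 -> x \in [:: t2, b & p2] -> False.
  by move=> x1 /dis /=; rewrite x1.
(* As t2 has at most one parent, the next node b on the path or else the preceding one is a child of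
   t2. *)
have [bc|nbc] := pselect (child b t2).
  apply: (key b bc); right; split.
    move=> d1; have bin : (b : level_tree) \in t1 :: rcons p1 t2.
      apply: desc_exit => //; first by rewrite rcons_path pp1.
      by rewrite last_rcons; exact: ndesc_child.
    move: bin; rewrite -rcons_cons mem_rcons in_cons => /orP[/eqP e|bin].
      by rewrite e eqxx in t2nb.
    by apply: (ndisj b bin); rewrite !in_cons eqxx orbT.
  rewrite -lp; apply: (@desc_stay b b p2) => //; first exact: desc_refl.
  by move=> z zp /(child_uniq bc) e; rewrite e zp in t2p2.
have tb : child t2 b by case/node_adjP: t2b.
have ac : child (last t1 p1) t2.
  case/node_adjP: at2 => // c.
  exfalso; apply: (ndisj b); last by rewrite !in_cons eqxx orbT.
  by rewrite -(child_uniq c tb) mem_last.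
apply: (key _ ac); left; split.
  apply: (desc_back pp1); first exact: desc_refl.
  move=> z zp /(child_uniq ac) e; apply: (ndisj z zp); rewrite -e; exact: mem_head.
move=> d3; have : (last t1 p1 : level_tree) \in b :: p2.
  apply: (@desc_enter _ t2); [exact: pbp|exact: ndesc_child|by rewrite lp].
by move=> h; apply: (ndisj (last t1 p1)); [exact: mem_last|rewrite in_cons h orbT].
Qed.

Definition level_td : tree_decomposition G :=
  TreeDecomposition level_treeP part_vertex part_edge part_path.
Local Notation D := level_td.

Lemma side_desc b s t : child b s -> side (D := D) b s t -> desc b t.
Proof.
move=> c [p pp <-]; elim/last_ind: p pp => [_|p z IH]; first exact: desc_refl.
rewrite rcons_path last_rcons => /andP[/IH dl /and3P[lz n1 n2]].
have [//|[e cz]] := desc_step dl lz.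
by rewrite e (child_uniq c cz) eqxx in n1.
Qed.

Lemma side_ndesc b s t : child b s -> side (D := D) s b t -> ~ desc b t.
Proof.
move=> c [p pp <-]; elim/last_ind: p pp => [_|p z IH]; first exact: ndesc_child.
rewrite rcons_path last_rcons => /andP[/IH dl /and3P[lz n1 n2]] dz.
rewrite adj_sym in lz.
have [//|[e cz]] := desc_step dz lz.
by rewrite e -(child_uniq c cz) eqxx in n1.
Qed.

Lemma adhesion_child b s : child b s -> adhesion (D := D) b s = nb (cs b).
Proof.
move=> c; apply/seteqP; split => v.
  move=> [bv sv]; have [|//] := part_desc (desc_refl b) bv.
  by move=> h; case: (part_ndesc (ndesc_child c) sv).
by move=> nv; split; [left|exact: nb_child nv].
Qed.

Lemma side_part_child b s : child b s ->
  side_part (D := D) b s `\` adhesion (D := D) b s = cs b.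
Proof.
move=> c; rewrite adhesion_child //; apply/seteqP; split => v.
  by move=> [[t /(side_desc c) d tv] nv]; have [] := part_desc d tv.
move=> bv; split; last by case.
have [//|[t /(side_ndesc c) d tv]] := side_part_or (D := D) b s v.
by case: (part_ndesc d tv).
Qed.

(** * The map from the ends of G to the level tree *)

Hypothesis Wgood : forall n, good (W n).

Lemma fbd_cs b : fbd (cs b).
Proof.
have [v bv] := cs_nonempty b; rewrite (csE bv).
by have [] := Wgood (cs_out bv).
Qed.

Lemma level_finite_adhesion : finite_adhesion D.
Proof.
move=> x y /adjP[c|c]; last by rewrite adhesion_child //; exact: fbd_cs.
by rewrite adhesionC adhesion_child //; exact: fbd_cs.
Qed.
Local Notation fD := level_finite_adhesion.

Lemma oriented_child w b s : child b s -> oriented_to (D := D) w b s <-> lives (cs b) w.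
Proof.
move=> c; have bs : adj (s := td_tree D) b s by apply/adjP; right.
by rewrite (orientedP fD _ bs) side_part_child.
Qed.

Lemma oriented_parent w b s : child b s -> oriented_to (D := D) w s b <-> ~ lives (cs b) w.
Proof.
move=> c; have bs : adj (s := td_tree D) b s by apply/adjP; right.
rewrite -(oriented_child w c); split; last by have [] := oriented_or fD w bs.
by move=> o1 o2; exact: (oriented_disj fD bs o2 o1).
Qed.

Definition top t w := lives (cs t) w /\ forall s, child s t -> ~ lives (cs s) w.

Lemma lives_desc s t w : (lv s <= lv t)%N -> lives (cs s) w -> lives (cs t) w -> desc s t.
Proof.
move=> le ls lt; have [v [sv tv]] := lives_ext (fbd_cs s) ls lt.
by split => //; exact: cs_nested le sv tv.
Qed.

Lemma lives_eq s t w : lv s = lv t -> lives (cs s) w -> lives (cs t) w -> s = t.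
Proof.
move=> e ls lt; have [v [sv tv]] := lives_ext (fbd_cs s) ls lt.
exact: node_eq e sv tv.
Qed.

Lemma side_or_desc (x y t : level_tree) : adj x y -> side (D := D) x y t ->
  (child x y /\ desc x t) \/ (child y x /\ ~ desc y t).
Proof.
move=> /adjP[c|c] st; [right|left]; split => //; first exact: side_ndesc st.
exact: side_desc st.
Qed.

Lemma oriented_desc (x y t : level_tree) w : adj x y -> side (D := D) x y t ->
  lives (cs t) w -> (child y x -> ~ desc y t -> ~ lives (cs y) w) -> oriented_to (D := D) w x y.
Proof.
move=> xy st lt h; have [[c [_ d]]|[c d]] := side_or_desc xy st.
  by apply/oriented_child => //; exact: livesS lt.
by apply/oriented_parent => //; exact: h.
Qed.

Lemma points_toP t w : points_to (D := D) w (inl t) <-> top t w.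
Proof.
split => [pt|[lt nt] x y xy st].
  split.
    case e : (lv t) => [|m].
      have [v tv] := cs_nonempty t; rewrite (csE tv) e W0 setC0.
      by apply: livesS (livesT w) => x _; exact: Gc.2.
    have [s c] := parent_exists e; apply/(oriented_child w c); apply: pt; last exact: side_refl.
    by apply/adjP; right.
  move=> s c; apply/(oriented_parent w c); apply: pt; last exact: side_refl.
  by apply/adjP; left.
apply: (oriented_desc xy st lt) => c nd ly.
have lt' : (lv t < lv y)%N.
  by rewrite ltnNge; apply/negP => le; apply: nd; exact: lives_desc le ly lt.
have [v [yv tv]] := lives_ext (fbd_cs y) ly lt.
have [s se sv] : exists2 s, lv s = (lv t).+1 & cs s v.
  by apply: node_of => /(Wmon lt'); exact: cs_out yv.
apply: (nt s); first exact: childP se tv sv.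
by apply: livesS ly; apply: cs_nested sv yv; rewrite se.
Qed.

(** Parents are unique, so a ray that once moves to a child never turns back, and it cannot move to
    parents forever. *)
Lemma ray_climbs (r : nat -> level_tree) : is_ray r ->
  exists n0, forall n, child (r (n0 + n).+1) (r (n0 + n)%N).
Proof.
move=> rr.
have up n : child (r n.+1) (r n) -> child (r n.+2) (r n.+1).
  move=> c; have /adjP[//|c'] := rr.2 n.+1.
  by have /rr.1 /eqP := child_uniq c c'; rewrite ltn_eqF.
have ex m n : (lv (r n) <= m)%N -> exists n', child (r n'.+1) (r n').
  elim: m n => [|m IH] n; have /adjP[c|[e _]] := rr.2 n; try by exists n.
    by rewrite e.
  by rewrite e ltnS; exact: IH.
have [n0 c] := ex _ 0%N (leqnn _); exists n0; elim=> [|n IH]; first by rewrite addn0.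
by rewrite addnS; exact: up.
Qed.

Lemma lv_climb (r : nat -> level_tree) n0 : (forall n, child (r (n0 + n).+1) (r (n0 + n)%N)) ->
  forall n, lv (r (n0 + n)%N) = (lv (r n0) + n)%N.
Proof.
move=> c; elim=> [|n IH]; first by rewrite !addn0.
by have [e _] := c n; rewrite !addnS e IH.
Qed.

Lemma points_to_endP (eta : ends level_tree) r w : val eta r ->
  points_to (D := D) w (inr eta) <-> (forall N, exists n, [/\ (N <= n)%N, (N <= lv (r n))%N & lives (cs (r n)) w]).
Proof.
move=> er; have rr := end_ray er; split => [pt N|h x y xy].
  have [n0 cl] := ray_climbs rr; have lvr := lv_climb cl.
  exists (n0 + N).+1; split; first exact/leqW/leq_addl.
    by rewrite -addnS lvr addnS; exact/leqW/leq_addl.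
  apply/(oriented_child w (cl N)); apply: pt; first by apply/adjP; right; exact: cl.
  by move=> r'; exact: ray_side.
move=> /(_ r er)[m hm].
have [n [mn ln lw]] := h (m + lv y)%N.
have st := hm n (leq_trans (leq_addr _ _) mn).
apply: (oriented_desc xy st lw) => c nd ly; apply: nd.
exact: lives_desc (leq_trans (leq_addl _ _) ln) ly lw.
Qed.

(** The finite boundary of a set K lies in some [W N], so a component of level at least N that meets
    K lies in K. *)
Lemma deep_ends_eq w w' : (forall N, exists t, [/\ (N <= lv t)%N, lives (cs t) w & lives (cs t) w']) ->
  w = w'.
Proof.
move=> h; apply: ends_eq => K fK lK.
have [N nbN] : exists N, nb K `<=` W N.
  have /choice[g gP] := Wcup.
  have /finite_fsetP[Y eY] := fK.
  exists (\max_(v <- finmap.enum_fset Y) g v) => v vK.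
  apply: (Wmon (m := g v)); last exact: gP.
  by move: vK; rewrite eY => vY; apply: (@leq_bigmax_seq _ _ xpredT g).
have [t [Nt lt lt']] := h N; apply: livesS lt'.
have [v [Kv tv]] := lives_ext fK lK lt.
apply: (conn_in (@cs_conn t) _ tv Kv) => x [tx /nbN Wx].
by apply: (cs_out tx); exact: Wmon Nt _ Wx.
Qed.

(** If w is mapped to no node, it lives in a component of every level, and these components form a
    ray of the tree. *)
Lemma end_map_points w : points_to (D := D) w (end_map D w).
Proof.
apply: (@xgetPex _ _ (points_to (D := D) w)).
have [[t tt]|nt] := pselect (exists t, top t w); first by exists (inl t); apply/points_toP.
have lev n : exists t, lv t = n /\ lives (cs t) w.
  elim: n => [|n [t [tn lt]]].
    have [[v _] _] := Gc; have [t t0 tv] : exists2 t, lv t = 0%N & cs t v by apply: node_of; rewrite W0.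
    exists t; split => //; rewrite (csE tv) t0 W0 setC0.
    by apply: livesS (livesT w) => x _; exact: Gc.2.
  have [s [c ls]] : exists s, child s t /\ lives (cs s) w.
    apply: contrapT => ns; apply: nt; exists t; split => // s c ls; apply: ns; by exists s.
  by exists s; split => //; case: c => -> _; rewrite tn.
have /choice[r rP] := lev.
have rr : is_ray (r : nat -> level_tree).
  split; first by move=> i j e; rewrite -(rP i).1 e (rP j).1.
  move=> n; apply/adjP; left; split; first by rewrite (rP n).1 (rP n.+1).1.
  have [] := @lives_desc (r n) (r n.+1) w _ (rP n).2 (rP n.+1).2 => //.
  by rewrite (rP n).1 (rP n.+1).1.
exists (inr (end_of rr)); apply/(points_to_endP _ (end_of_mem rr)) => N.
by exists N; split => //; [rewrite (rP N).1|exact: (rP N).2].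
Qed.

Hypothesis Wstep : forall n, step (W n) (W n.+1).

Lemma step_top t : exists w0, forall w, top t w <-> w = w0.
Proof.
have [u tu] := cs_nonempty t.
have [_ /(_ u (cs_out tu)) [w0 []]] := Wstep (lv t); rewrite -(csE tu) => l0 h.
exists w0 => w; split => [[lt nt]|->].
  apply/(h w lt) => v Wv lv'; have [s se sv] := node_of Wv.
  rewrite -se -(csE sv) in lv'; apply: (nt s) => //.
  have [x [tx sx]] := lives_ext (fbd_cs t) lt lv'.
  exact: childP se tx sx.
split => // s [e _]; have [v sv] := cs_nonempty s; rewrite (csE sv) e.
by apply: (h w0 l0).1 => //; rewrite -e; exact: cs_out sv.
Qed.

Lemma end_map_inj : injective (end_map D).
Proof.
move=> w w' e; have := @end_map_points w; have := @end_map_points w'; rewrite -e.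
case: (end_map D w) => [t /points_toP t1 /points_toP t2|eta].
  by have [w0 h] := step_top t; rewrite (h w).1 // (h w').1.
have [r er] := end_nonempty eta => /(points_to_endP _ er) h' /(points_to_endP _ er) h.
have [n0 cl] := ray_climbs (end_ray er); have lvr := lv_climb cl.
apply: deep_ends_eq => N.
have [n [n1 n2 l]] := h (n0 + N)%N.
have [n' [n1' n2' l']] := h' n.
have d k : cs (r (n + k)%N) `<=` cs (r n).
  elim: k => [|k IH]; first by rewrite addn0.
  have nk : (n0 <= n + k)%N.
    by apply: leq_trans (leq_addr _ _); exact: leq_trans (leq_addr _ _) n1.
  rewrite addnS; have := cl (n + k - n0)%N; rewrite subnKC // => -[_ sub].
  exact: subset_trans sub IH.
exists (r n); split => //; first exact: leq_trans (leq_addl _ _) n2.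
by apply: livesS l'; rewrite -(subnKC n1').
Qed.

Lemma end_map_surj z : exists w, end_map D w = z.
Proof.
case: z => [t|eta].
  have [w0 h] := step_top t; exists w0; apply: (end_map_node fD).
  by apply/points_toP/h.
have [r er] := end_nonempty eta; have rr := end_ray er.
have [n0 cl] := ray_climbs rr; have lvr := lv_climb cl.
(* A ray of G through the nested components along r: each vertex is in some [W n] and so drops out
   of them. *)
have [|||v|q [rq q0 qE]] := @escape_ray G (fun n => cs (r (n0 + n)%N)).
- by move=> n; rewrite addnS; case: (cl n).
- by move=> n; exact: cs_conn.
- by move=> n; exact: cs_nonempty.
- have [n Wn] := Wcup v; exists n => /cs_out; apply; apply: Wmon Wn.
  by rewrite lvr leq_addl.
exists (end_of rq).
have deep N : exists n, [/\ (N <= n)%N, (N <= lv (r n))%N & lives (cs (r n)) (end_of rq)].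
  exists (n0 + N)%N; split; [exact: leq_addl|by rewrite lvr leq_addl|].
  by apply/lives_end_of; [exact: fbd_cs|exact: qE].
have pt : points_to (D := D) (end_of rq) (inr eta) by apply/(points_to_endP _ er).
have := @end_map_points (end_of rq); case: (end_map D _) => [t /(points_to_node fD) h|eta'].
  by have := h _ pt.
have [r' er'] := end_nonempty eta' => /(points_to_endP _ er') deep'.
(* The end of q lives in one component per level, so r and r' share nodes of arbitrarily large
   level, and no K of finite boundary can separate eta from eta'. *)
congr inr; apply: ends_eq => K fK lK.
have [m1 h1] := livesP fK lK er'.
have [//|nl] := tail_dich rr fK; first by exists r.
have [m2 h2] := nl.
have [n0' cl'] := ray_climbs (end_ray er'); have lvr' := lv_climb cl'.
have [n' [n1' n2' l']] := deep' (m1 + n0' + lv (r (n0 + m2)%N))%N.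
have le : (lv (r n0) <= lv (r' n'))%N.
  apply: leq_trans n2'; rewrite lvr; apply: leq_trans (leq_addl _ _).
  exact: leq_addr.
pose n := (n0 + (lv (r' n') - lv (r n0)))%N.
have en : r n = r' n'.
  apply: (@lives_eq _ _ (end_of rq)) => //; first by rewrite lvr subnKC.
  by apply/lives_end_of; [exact: fbd_cs|exact: qE].
have m2n : (m2 <= n)%N.
  rewrite /n; apply: leq_trans (leq_addl _ _); rewrite leq_subRL //.
  by apply: leq_trans n2'; rewrite lvr; exact: leq_addl.
have m1n : (m1 <= n')%N by apply: leq_trans n1'; rewrite -addnA leq_addr.
by case: (h2 n m2n); left; rewrite en; exact: h1.
Qed.

Lemma level_represents : represents_ends D.
Proof.
have /choice[g gP] := end_map_surj.
by exists g => // w; apply: end_map_inj; rewrite gP.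
Qed.

End LevelTree.

(** * Ends in the topology of |G| *)

Section Topology.
Import Order.TTheory GRing.Theory Num.Theory.
Local Open Scope ring_scope.
Variables (R : realType) (G : sgraph).
Implicit Types (A : set (mspace R G)) (K L X F S U : set G) (u v : G) (w : ends G).

Lemma mnbhsP (z : mspace R G) A :
  nbhs z A <-> exists B, [/\ mtop_base B, B z & B `<=` A].
Proof.
rewrite nbhsE; split.
  move=> [B [[D' D'base <-] [C D'C Cz]] BA]; exists C; split => //; first exact: D'base.
  by move=> y Cy; apply: BA; exists C.
move=> [B [bB Bz BA]]; exists B => //; split => //; exists [set B].
  by move=> _ ->.
by rewrite bigcup_set1.
Qed.

Lemma end_comp_fbd X w : finite_set X ->
  [/\ fbd (end_comp X w), conn (end_comp X w), end_comp X w `<=` ~` X & lives (end_comp X w) w].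
Proof.
move=> fX; have [[u uX e] t] := end_compP w fX; rewrite e in t *; split.
- exact/fbd_comp/fbdC.
- exact: comp_conn.
- exact: comp_sub.
- by have [r wr] := end_nonempty w; exists r => //; exact: t.
Qed.

Lemma lives_end_comp X w w' : finite_set X -> lives (end_comp X w) w' ->
  end_comp X w' = end_comp X w.
Proof.
move=> fX l; have [fK cK KX _] := end_comp_fbd w fX.
have [_ _ _ l'] := end_comp_fbd w' fX.
have [v [Kv K'v]] := lives_ext fK l l'.
by apply: (component_eq (end_compP w' fX).1 (end_compP w fX).1 K'v Kv).
Qed.

Lemma nbhs_end w A : nbhs (inr w : mspace R G) A ->
  exists K, [/\ fbd K, lives K w, forall w', lives K w' -> A (inr w') &
    forall v, K v -> A (vertex_pt R v)].
Proof.
move=> /mnbhsP[B [[[O _ ->] [//]|[X [w0 [e [fX e01 ->]]]] /= ew BA]]].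
have [fK cK KX lK] := end_comp_fbd w fX.
exists (end_comp X w); split => //.
  by move=> w' l; apply: BA => /=; rewrite (lives_end_comp fX l).
move=> v Kv; apply: BA; left; exists v, v, 0; rewrite -ew; split => //; first by left.
by rewrite lexx ler01.
Qed.

Lemma vertex_pt_seg v u x (t : R) : u = x \/ adj u x -> seg v v 0 = seg u x t -> v = u \/ v = x /\ t = 1.
Proof.
move=> ux /(congr1 (fun f => f v)); rewrite seg_id => e.
have [vu|vu] := eqVneq v u; [by left|right].
have [vx|vx] := eqVneq v x; last by move: e; rewrite seg_out // => /eqP; rewrite oner_eq0.
by split => //; move: e; rewrite {1}vx seg_r // -vx eq_sym.
Qed.

(** The component of G - [nb K] in which w lives lies in K. Its basic neighbourhood for 1/2 has no
    vertex outside it, since the other end of a partial edge is at distance 1. *)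
Lemma nbhs_end_of K w : fbd K -> lives K w -> exists A, [/\ nbhs (inr w : mspace R G) A,
  forall w', A (inr w') -> lives K w' & forall v, A (vertex_pt R v) -> K v].
Proof.
move=> fK lK; have [fC cC CX lC] := end_comp_fbd w fK.
have CK : end_comp (nb K) w `<=` K.
  have [v [Kv Cv]] := lives_ext fK lK lC.
  by apply: (conn_in cC) Cv Kv => x [/CX].
have h01 : (0 < 2^-1 :> R) && (2^-1 < 1 :> R) by rewrite invr_gt0 ltr0n invf_lt1 ?ltr1n ?ltr0n.
exists (end_nbhd (nb K) w 2^-1); split.
- apply/mnbhsP; exists (end_nbhd (nb K) w 2^-1); split => //.
  by right; exists (nb K), w, 2^-1.
- move=> w' /= e; apply: livesS CK _; rewrite -e.
  by have [] := end_comp_fbd w' fK.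
- move=> v [] [u [x [t [Cu Cx]]]].
    by move=> ux _ /(vertex_pt_seg ux)[->|[-> _]]; exact: CK.
  move=> ux /andP[_ th] /(vertex_pt_seg (or_intror ux))[->|[_ t1]]; first exact: CK.
  by move: th; rewrite t1; case/andP: h01 => _ /lt_trans /[apply]; rewrite ltxx.
Qed.

Definition cb_ends U j : set (ends G) :=
  [set w | cb_derivative j (closure (@vertex_pt R G @` U)) (inr w)].

(** The interior of a neighbourhood that isolates a point of B misses the derivative. *)
Lemma closed_derivative (T : topologicalType) (B : set T) : closed B -> closed (B `\` isolated B).
Proof.
move=> cB; rewrite -[X in closed X]setCK; apply: open_closedC; rewrite openE => x.
rewrite /interior; have [Bx|Bx] := pselect (B x); last first.
  have := closed_openC cB; rewrite openE => /(_ x Bx) nB.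
  by move=> _; apply: filterS nB => y By [].
move=> nx; have [_ [V Vx VB]] : isolated B x by apply: contrapT => nI; apply: nx.
apply: filterS (nbhs_interior Vx) => y iVy [By nI].
have Vy : V y by exact: nbhs_singleton.
have yx : [set x] y by rewrite -VB.
rewrite yx in nI; apply: nI; split; first exact/mem_set.
by exists V.
Qed.

Lemma cb_closed U j : closed (cb_derivative j (closure (@vertex_pt R G @` U))).
Proof.
elim: j => [|j IH]; first exact: closed_closure.
exact: closed_derivative.
Qed.

Lemma cb_ends_closed D U j : closed_in D (cb_ends U j).
Proof.
move=> w _ nE; have := closed_openC (cb_closed (j := j) (U := U)); rewrite openE => /(_ _ nE).
move=> /nbhs_end[K [fK lK Kw _]]; exists K; split => // w' Ew' /Kw; exact.
Qed.

Lemma cb_ends_discrete D U j : (forall w, lives D w -> ~ cb_ends U j.+1 w) ->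
  discrete_in D (cb_ends U j).
Proof.
move=> h w lD Ew; have [_ [V Vw VE]] :
    isolated (cb_derivative j (closure (@vertex_pt R G @` U))) (inr w).
  by apply: contrapT => nI; apply: (h w lD).
have [K [fK lK Kw _]] := nbhs_end Vw; exists K; split => // w' Ew' lw'.
have : [set (inr w : mspace R G)] (inr w') by rewrite -VE; split => //; exact: Kw.
by case.
Qed.

Lemma cb_ends0 U w : ~ cb_ends U 0 w -> ~ sticks U w.
Proof.
move=> nE st; apply: nE => B /nbhs_end[K [fK lK _ Kv]].
have [v [KKv Uv]] := st K fK lK.
by exists (vertex_pt R v); split; [exists v|exact: Kv].
Qed.

End Topology.

(** * Vertices and inner points of edges *)

Section Points.
Import Order.TTheory GRing.Theory Num.Theory.
Local Open Scope ring_scope.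
Variables (R : realType) (G : sgraph).
Implicit Types (U : set G) (p q : geom_complex R G) (u v : G) (a : R).

Lemma nbhs_coord p u a : a < val p u ->
  nbhs (inl p : mspace R G) (inl @` [set q : geom_complex R G | a < val q u]).
Proof.
move=> ap; apply/mnbhsP; exists (inl @` [set q : geom_complex R G | a < val q u]); split => //.
  left; exists [set q : geom_complex R G | a < val q u] => // q /= aq.
  exists (val q u - a); first by rewrite subr_gt0.
  by move=> x /= /(dist_gt u); rewrite subKr.
Qed.

(** An inner point of an edge has two positive coordinates, and so have all points near it, but no
    vertex has. *)
Lemma closure_vertices U p : closure (@vertex_pt R G @` U) (inl p) ->
  exists u, inl p = vertex_pt R u.
Proof.
have seguu u t : seg u u t = seg u u 0 :> (G -> R).
  by apply/funext => x; rewrite /seg -mulrDl subrK mul1r subr0 mul1r mul0r addr0.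
have vtx u t : val p = seg u u t -> exists u, inl p = vertex_pt R u.
  by move=> e; exists u; congr inl; apply/val_inj; rewrite /= e seguu.
have [u [v [t [uv /andP[t0 t1] e]]]] := set_mem (valP p).
have [euv|nuv] := eqVneq u v; first by move=> _; rewrite -euv in e; exact: vtx e.
move: t0; rewrite le_eqVlt => /orP[/eqP e0|t0].
  by move=> _; apply: (vtx u 0); rewrite e -e0 !seg0.
move: t1; rewrite le_eqVlt => /orP[/eqP e1|t1].
  by move=> _; apply: (vtx v 0); rewrite e e1 segC subrr !seg0.
have pu : 0 < val p u by rewrite e seg_l // subr_gt0.
have pv : 0 < val p v by rewrite e seg_r.
move=> /(_ _ (filterI (nbhs_coord pu) (nbhs_coord pv))) [_ [[x Ux <-]]].
move=> [[q /= qu [eq1]] [q' /= q'v [eq2]]]; exfalso; move: qu q'v; rewrite eq1 eq2 /=.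
rewrite !seg0; have [<-|_] := eqVneq u x; last by rewrite ltxx.
by move=> _; rewrite eq_sym (negbTE nuv) ltxx.
Qed.

(** The points with coordinate above 1/2 at u form a neighbourhood of u without other vertices. *)
Lemma derivative_vertices U p : ~ cb_derivative 1 (closure (@vertex_pt R G @` U)) (inl p).
Proof.
move=> [cp]; apply; split; first exact/mem_set.
have [u pe] := closure_vertices cp.
have h : 2^-1 < val p u.
  by case: pe => ->; rewrite /= seg_id invf_lt1 ?ltr1n ?ltr0n.
exists (inl @` [set q : geom_complex R G | 2^-1 < val q u]); first exact: nbhs_coord.
apply/seteqP; split=> [z [[q /= qu <-] cq]|_ ->]; last first.
  by split => //; exists p.
have [x qx] := closure_vertices cq; rewrite qx pe.
move: qu; case: qx => -> /=; rewrite seg0; have [->//|_] := eqVneq u x.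
by rewrite invr_lt0 ltNge ler0n.
Qed.

Lemma closure_ends U w : closure (@vertex_pt R G @` U) (inr w) -> sticks U w.
Proof.
move=> cw K fK lK; have [A [nA _ AK]] := nbhs_end_of R fK lK.
have [_ [[u Uu <-] /AK Ku]] := cw _ nA.
by exists u.
Qed.

Lemma cb_derivativeS (T : topologicalType) j (A : set T) x :
  cb_derivative j.+1 A x = (cb_derivative j A x /\ ~ isolated (cb_derivative j A) x).
Proof. by []. Qed.

End Points.

(** * Slenderness of the parts up to a given level *)

Section PartsSlender.
Variables (R : realType) (G : sgraph) (D : tree_decomposition G).
Local Notation T := (td_tree D).
Implicit Types (t : T) (w : ends G).

Lemma parts_slender : finite_adhesion D -> at_most_one_ended_parts D ->
  exists U : nat -> set G, (forall n, slender R (U n)) /\ \bigcup_n U n = setT.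
Proof.
move=> fD one; have [[t0 _] _] := (td_treeP D).1.
have [lev [lev0 lev1 par levs]] := level_exists t0.
exists (fun n => \bigcup_(t in [set t | (lev t <= n)%N]) td_part t); split; last first.
  apply/seteqP; split => // v _; have [t tv] := td_vertex D v.
  by exists (lev t) => //; exists t => /=.
move=> n; set U := \bigcup_(t in _) _.
set Y := closure (@vertex_pt R G @` U).
have Y1 j p : ~ cb_derivative j.+1 Y (inl p).
  elim: j => [|j IH]; first exact: derivative_vertices.
  by rewrite cb_derivativeS => -[].
(* The end of a part at level m is isolated once the ends of the parts at levels
   above m are gone: the edge from that part to its parent separates it. *)
have claim j : cb_derivative j.+1 Y `<=` [set z | exists w t,
    [/\ z = inr w, points_to (D := D) w (inl t) & (lev t + j <= n)%N]].
  elim: j => [|j IH] [p|w]; try by move=> /Y1.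
    move=> [/closure_ends /(part_end_level fD lev0 lev1 levs)[t lt pt] _].
    by exists w, t; rewrite addn0.
  move=> Yw; have := Yw; rewrite cb_derivativeS => -[Yj nI].
  have [_ [t [[<-] pt lt]]] := IH _ Yj; exists w, t; split => //.
  rewrite leq_eqVlt in lt; case/orP: lt => [/eqP lt|]; last by rewrite addnS.
  exfalso; apply: nI; split; first exact/mem_set.
  have uniq w' t' : points_to (D := D) w' (inl t') -> t' = t -> w' = w.
    by move=> pt' e; apply: (one t); apply: end_map_node => //; rewrite -e.
  have [K [fK lK Kw]] : exists K, [/\ fbd K, lives K w & forall w' t',
      lives K w' -> points_to (D := D) w' (inl t') -> (lev t' <= lev t)%N -> t' = t].
    case ltm : (lev t) => [|m].
      exists setT; split; [exact: fbdT|exact: livesT|].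
      move=> w' t' _ _; rewrite leqn0 => /eqP /lev0 ->.
      by apply/esym/lev0.
    have [p pt' lp] := par _ _ ltm; have tp : adj t p by rewrite adj_sym.
    exists (side_part t p `\` adhesion t p); split; first exact: fbd_side.
      by apply/orientedP => //; apply: pt => //; exact: side_refl.
    move=> w' t' /(orientedP fD _ tp) o pw' lt'.
    have [h|h] := side_or t p t'; last first.
      by case: (oriented_disj fD tp o); exact: pw'.
    apply: contrapT => ne; have := levs p t pt' lp t' h ne.
    by rewrite ltm ltnNge lt'.
  have [A [nA Aw _]] := nbhs_end_of R fK lK.
  exists A => //; apply/seteqP; split => [z [Az Yz]|_ ->]; last first.
    by split => //; exact: nbhs_singleton nA.
  have [w' [t' [ez pt' lt']]] := IH _ Yz; rewrite ez in Az *.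
  congr inr; apply: (uniq w' t' pt'); apply: (Kw w' t' (Aw _ Az) pt').
  by rewrite -(leq_add2r j) lt.
(* One derivative deletes the vertices, and n + 1 suffice for the ends of the parts at levels n down
   to 0. *)
exists n.+2; apply/seteqP; split => // z /claim[w [t [_ _]]].
by rewrite addnS ltnNge leq_addl.
Qed.

End PartsSlender.

(** * The cycle of implications *)

Theorem theorem1p1 (R : realType) (G : sgraph) :
  connected_graph G -> [set: ends G] !=set0 ->
  [<-> exists D : tree_decomposition G, finite_adhesion D /\ represents_ends D;
       exists D : tree_decomposition G, finite_adhesion D /\ distinguishes_ends D;
       exists D : tree_decomposition G,
         finite_adhesion D /\ at_most_one_ended_parts D;
       exists U : nat -> set G,
         (forall n, slender R (U n)) /\ \bigcup_n U n = [set: G] ].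
Proof.
move=> Gc Gend; tfae.
- by move=> [D [fD rD]]; exists D; split => //; exact: bij_inj.
- move=> [D [fD iD]]; exists D; split => // t w w' e e'.
  by apply: iD; rewrite e e'.
- by move=> [D [fD oD]]; exact: parts_slender fD oD.
move=> [U [Us Ucup]].
have [||||W [W0 Wgood Wstep Wcup]] :=
    @levels G U (fun k => cb_ends R (U k)) Gc Gend _ _ _ _ Ucup.
- by move=> k D j; exact: cb_ends_closed.
- by move=> k D j; exact: cb_ends_discrete.
- by move=> k w; exact: cb_ends0.
- move=> k; have [N UN] := Us k; exists N; apply/seteqP; split => // w.
  by rewrite /cb_ends /= UN.
have Wmon m n : (m <= n)%N -> W m `<=` W n.
  elim: n => [|n IH]; first by rewrite leqn0 => /eqP ->.
  rewrite leq_eqVlt => /orP[/eqP ->//|mn].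
  exact: subset_trans (IH mn) (Wstep n).1.
exists (level_td Wmon W0 Gc Wcup); split; first exact: level_finite_adhesion.
exact: level_represents.
Qed.
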